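(* For every finite group $G$, we have $\mathrm{modl}(G)=\mathrm{chiefl}(G)$. In other words, no chain of modular elements in $\mathcal{L}(G)$ is longer than a chief series of $G$.
   Context: For a finite group $G$, $\mathcal{L}(G)$ denotes the lattice of all subgroups of $G$ ordered by inclusion, with meet $H\wedge K=H\cap K$ and join $H\vee K=\langle H,K\rangle$. A chain in $\mathcal{L}(G)$ is a subset totally ordered by inclusion; the length of a chain is its number of elements minus one. An element $m$ of a lattice $L$ is modular in $L$ if both (i) $x\vee(m\wedge y)=(x\vee m)\wedge y$ for all $x,y\in L$ with $x\le y$, and (ii) $m\vee(x\wedge n)=(m\vee x)\wedge n$ for all $x,n\in L$ with $m\le n$. $\mathrm{modl}(G)$ is the maximum length of a chain in $\mathcal{L}(G)$ all of whose elements are modular in $\mathcal{L}(G)$. $\mathrm{chiefl}(G)$ is the length of a chief series of $G$, i.e. of a chain $1=N_0<N_1<\dots<N_r=G$ of normal subgroups of $G$ that cannot be refined by inserting further normal subgroups of $G$ (its length is $r$, which is independent of the chief series). *)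

(* Defs.v *)
From mathcomp Require Import all_boot all_fingroup all_solvable.

Set Implicit Arguments.
Unset Strict Implicit.
Unset Printing Implicit Defensive.

Local Open Scope group_scope.

Section SubgroupLattice.

Variable gT : finGroupType.
Implicit Types (G M X Y N : {group gT}) (C : {set {group gT}}).

(* The lattice L(G) is [subgroups G], ordered by \subset, with meet :&: and
   join <*>. *)
Definition modular_in G M : bool :=
  [&& M \in subgroups G,
      [forall X in subgroups G, forall Y in subgroups G,
         (X \subset Y) ==> (X <*> (M :&: Y) == (X <*> M) :&: Y)]
    & [forall X in subgroups G, forall N in subgroups G,
         (M \subset N) ==> (M <*> (X :&: N) == (M <*> X) :&: N)]].

Definition chain_in G C : bool :=
  (C \subset subgroups G)
  && [forall X in C, forall Y in C, (X \subset Y) || (Y \subset X)].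

(* Only meaningful for C != set0; the truncated value 0 at set0 does not
   affect the maximum in modl. *)
Definition chain_length C : nat := #|C|.-1.

Definition modular_chain G C : bool :=
  chain_in G C && [forall M in C, modular_in G M].

Definition modl G : nat :=
  \max_(C : {set {group gT}} | modular_chain G C) chain_length C.

(* The leading term N_0 = 1 of the series is not listed in s, so the series
   1 = N_0 < N_1 < ... < N_r = G has length r = size s. *)
Definition chief_series G (s : seq {group gT}) : bool :=
  (G.-chief).-series 1%G s && (last 1%G s == G).

End SubgroupLattice.

(* Main.v *)
Require Import Defs.
From mathcomp Require Import all_boot all_fingroup all_solvable.
From mathcomp Require Import vcharacter integral_char.

(* A modular subgroup M covers or avoids every chief factor K/N of G, that is,
   MN contains K or meets K in N.  Hence M is determined, within a chain of
   modular subgroups, by the set of chief factors it covers, which grows strictly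
   along the chain; so the chain has at most r + 1 members.  Conversely the
   members of a chief series, being normal, are modular.

   For the cover-avoidance property take N minimal normal in G and A = M :&: N.
   If x is a p-element, the interval from M to <M, x> embeds in the chain of
   subgroups of <x>; when A is neither 1 nor N this forces L' to centralise N for
   every normal subgroup L of G normalising A.
   - N nonabelian: a nonabelian simple group has no proper nontrivial modular
     subgroup, so N normalises A, and L = N gives a contradiction.
   - N a p-group: L can be the core of the normaliser of A, which contains all
     p'-elements of prime power order, and a Frattini argument applies to a Sylow
     subgroup of L acting nontrivially on N.
   The simple case follows Schmidt: a maximal modular subgroup M has prime index,
   and M modulo its core has order 1 or a smaller prime; then a permutability
   argument of Kegel and Burnside's p^a q^b theorem finish. *)

Set Implicit Arguments.
Unset Strict Implicit.
Unset Printing Implicit Defensive.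

Local Open Scope group_scope.

(** * Modular subgroups *)

Section ModularBasics.

Variable gT : finGroupType.
Implicit Types G H K L M N X Y Z W : {group gT}.

Lemma modularP G M :
  reflect [/\ M \subset G,
    forall X Y, Y \subset G -> X \subset Y -> X <*> (M :&: Y) = (X <*> M) :&: Y
  & forall X W, X \subset G -> W \subset G -> M \subset W ->
      M <*> (X :&: W) = (M <*> X) :&: W]
  (modular_in G M).
Proof.
apply: (iffP and3P) => [[]|[sMG mod1 mod2]]; rewrite !inE.
  move=> sMG /forall_inP-mod1 /forall_inP-mod2; split=> // X Y sG.
    move=> sXY; have sXG := subset_trans sXY sG.
    have /mod1/forall_inP/(_ Y) : X \in subgroups G by rewrite inE.
    by rewrite inE sG sXY => /(_ isT)/eqP.
  move=> sYG sMY.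
  have /mod2/forall_inP/(_ Y) : X \in subgroups G by rewrite inE.
  by rewrite inE sYG sMY => /(_ isT)/eqP.
split=> //; apply/forall_inP=> X; rewrite inE => sXG.
  apply/forall_inP=> Y; rewrite inE => sYG; apply/implyP=> sXY.
  by rewrite mod1.
apply/forall_inP=> W; rewrite inE => sWG; apply/implyP=> sMW.
by rewrite mod2.
Qed.

Lemma modular_sub G M : modular_in G M -> M \subset G.
Proof. by case/modularP. Qed.

Lemma modular_joinI G M X Z :
  modular_in G M -> X \subset G -> Z \subset X ->
  (M <*> Z) :&: X = Z <*> (M :&: X).
Proof. by case/modularP=> _ mod1 _ sXG sZX; rewrite mod1 // joingC. Qed.

Lemma modular_joinIW G M X W :
  modular_in G M -> X \subset G -> W \subset G -> M \subset W ->
  (M <*> X) :&: W = M <*> (X :&: W).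
Proof. by case/modularP=> _ _ mod2 sXG sWG sMW; rewrite mod2. Qed.

(** With [modular_capK] this makes joining with [M] and meeting with [X] inverse isomorphisms
    between the intervals from [M :&: X] to [X] and from [M] to [M <*> X]. *)
Lemma modular_joinK G M X Z :
    modular_in G M -> X \subset G -> Z \subset X -> M :&: X \subset Z ->
  (M <*> Z) :&: X = Z.
Proof.
move=> modM sXG sZX sMXZ; rewrite (modular_joinI modM) //.
exact/joing_idPl.
Qed.

Lemma modular_capK G M X W :
    modular_in G M -> X \subset G -> M \subset W -> W \subset M <*> X ->
  M <*> (X :&: W) = W.
Proof.
move=> modM sXG sMW sWMX.
have sMXG: M <*> X \subset G by rewrite join_subG (modular_sub modM).
rewrite -(modular_joinIW modM) //; first exact/setIidPr.
exact: subset_trans sWMX sMXG.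
Qed.

Lemma modularI G M X : X \subset G -> modular_in G M -> modular_in X (M :&: X)%G.
Proof.
move=> sXG modM; apply/modularP; split=> [|A B sBX sAB|A W sAX sWX sMXW] /=.
- exact: subsetIr.
- have sBG := subset_trans sBX sXG.
  rewrite -setIA (setIidPr sBX) -(modular_joinI modM) //.
  rewrite -(modular_joinI modM sXG) ?(subset_trans sAB) //.
  by rewrite -setIA (setIidPr sBX).
have sAG := subset_trans sAX sXG; have sWG := subset_trans sWX sXG.
rewrite joingC -(modular_joinI modM) ?subIset ?sAX //.
rewrite [_ <*> A]joingC -(modular_joinI modM) // -setIA (setIidPr sWX).
(* [W] need not contain [M], so the second law is applied to [M <*> W], whose trace on [X] is
   [W]. *)
have modW : (M <*> W) :&: X = W by apply: modular_joinK modM _ _ _.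
have <-: (A :&: (M <*> W))%G = (A :&: W)%G.
  by apply/val_inj; rewrite /= -[in RHS]modW setICA (setIidPl sAX) setIC.
have sMWG: M <*> W \subset G by rewrite join_subG (modular_sub modM).
have := modular_joinIW modM sAG sMWG (joing_subl _ _) => /= <-.
by rewrite -setIA modW.
Qed.

Lemma modularJ G M g : g \in G -> modular_in G M -> modular_in G (M :^ g)%G.
Proof.
move=> Gg modM; have sJ X : (X :^ g^-1)%G \subset G = (X \subset G).
  by rewrite /= sub_conjgV (conjGid Gg).

apply/modularP; split=> /= [|X Y sYG sXY|X W sXG sWG sMW].
- by rewrite -(conjGid Gg) conjSg (modular_sub modM).
- apply: (@conjsg_inj _ g^-1).
  have := @modular_joinI _ M (Y :^ g^-1)%G (X :^ g^-1)%G modM.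
  rewrite sJ /= conjSg => /(_ sYG sXY).
  by rewrite !(conjYg, conjIg) -!conjsgM mulgV conjsg1 joingC => ->.
apply: (@conjsg_inj _ g^-1).
have := @modular_joinIW _ M (X :^ g^-1)%G (W :^ g^-1)%G modM.
rewrite !sJ /= -sub_conjg => /(_ sXG sWG sMW).
by rewrite !(conjYg, conjIg) -!conjsgM mulgV conjsg1 => ->.
Qed.

Lemma normal_modular G K : K <| G -> modular_in G K.
Proof.
case/andP=> sKG nKG; apply/modularP; split=> // [X Y sYG sXY|X W sXG sWG sKW].
  have nKX : X \subset 'N(K) by apply: subset_trans (subset_trans sXY _) nKG.
  have nKY : X \subset 'N(K :&: Y).
    by rewrite normsI // (subset_trans sXY) ?normG.
  by rewrite /= norm_joinEl // norm_joinEl //= group_modl.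
have nKX : X \subset 'N(K) by apply: subset_trans sXG nKG.
rewrite /= !norm_joinEr ?subIset ?nKX //=.
by rewrite group_modl.
Qed.

(** A subgroup [Z] between [M :&: X] and [X] is recovered from [M <*> Z], which is [M] or [G]. *)
Lemma modular_maximalI G M X :
    modular_in G M -> maximal M G -> X \subset G -> ~~ (X \subset M) ->
  maximal (M :&: X)%G X.
Proof.
move=> modM /maxgroupP[/andP[sMG nsGM] maxM] sXG nsXM.
apply/maxgroupP; split.
  by rewrite /= properEneq subsetIr andbT; apply: contraNneq nsXM => <-; apply: subsetIl.
move=> Z /andP[sZX nsXZ] sMXZ; apply/eqP; rewrite eq_sym eqEsubset sMXZ /=.
have MZK := modular_joinK modM sXG sZX sMXZ.
have sMZG: M <*> Z \subset G by rewrite join_subG sMG (subset_trans sZX).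
have [sG|ns] := boolP (G \subset M <*> Z).
  by case/negP: nsXZ; rewrite -{1}MZK subsetI subxx (subset_trans sXG).
have /maxM E : M <*> Z \proper G by rewrite properE sMZG.
by rewrite subsetI sZX andbT -(E (joing_subl _ _)) joing_subr.
Qed.

Lemma modular_prime_maximal G M x :
    modular_in G M -> x \in G -> prime #[x] -> x \notin M ->
  maximal M (M <*> <[x]>)%G.
Proof.
move=> modM Gx pr_x nMx; have sxG : <[x]> \subset G by rewrite cycle_subG.
apply/maxgroupP; split.
  rewrite /= properE joing_subl /=; apply: contra nMx => /subsetP; apply.
  by rewrite mem_gen // inE cycle_id orbT.
move=> W /andP[/= sWM nsMW] sMW.
have /= WE := modular_capK modM sxG sMW sWM.
have pr := prime_subgroupVti (W : {group gT}) pr_x.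
case: pr => [sxW|tiW]; last by apply/val_inj; rewrite -WE /= setIC tiW joingG1.
by case/negP: nsMW; rewrite join_subG sMW.
Qed.

End ModularBasics.

Lemma quotient_modular (gT : finGroupType) (G K M : {group gT}) :
  K <| G -> modular_in G M -> modular_in (G / K)%G (M / K)%G.
Proof.
move=> nsKG modM; have [sKG nKG] := andP nsKG; have sMG := modular_sub modM.
have inv (X : {group coset_of K}) : X \subset G / K ->
    exists2 Y : {group gT}, [/\ K \subset Y, Y \subset G & Y \subset 'N(K)] & X :=: Y / K.
  move=> sX; have [Y defX sKY sYG] := inv_quotientS nsKG sX.
  by exists Y => //; split=> //; apply: subset_trans nKG.
have nKM := subset_trans sMG nKG.
apply/modularP; split=> [|X Y sYG sXY|X W sXG sWG sMW] /=.
- exact: quotientS.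
- have [X1 [sKX1 sX1G nKX1] defX] := inv _ (subset_trans sXY sYG).
  have [Y1 [sKY1 sY1G nKY1] defY] := inv _ sYG.
  move: sXY; rewrite defX defY quotientSGK // => sXY1.
  rewrite -quotientIG // -!quotientY ?subIset ?nKM //= -quotientIG //.
  by rewrite -(modular_joinI modM) // joingC.
have [X1 [sKX1 sX1G nKX1] defX] := inv _ sXG.
have [W1 [sKW1 sW1G nKW1] defW] := inv _ sWG.
move: sMW; rewrite defX defW quotientSGK // => sMW1.
rewrite -quotientIG // -!quotientY ?subIset ?nKX1 //= -quotientIG //.
by rewrite (modular_joinIW modM).
Qed.

(** * Maximal modular subgroups *)

Lemma pi_solvable (gT : finGroupType) (G : {group gT}) p q :
  (forall r, prime r -> r %| #|G| -> r = p \/ r = q) -> solvable G.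
Proof.
move=> pqG; apply: Burnside_p_a_q_b.
rewrite -[2]/(size [:: p; q]) uniq_leq_size ?primes_uniq // => r.
rewrite mem_primes => /and3P[pr_r _ /pqG] /(_ pr_r)[]->;
  by rewrite !inE eqxx ?orbT.
Qed.

Section GroupFacts.

Variable gT : finGroupType.
Implicit Types G H K L M N V X Y Z W : {group gT}.

Lemma minnormal_sub_eq V G H :
  minnormal V G -> H \subset V -> G \subset 'N(H) -> H :=: 1 \/ H :=: V.
Proof.
case/mingroupP=> [_ minV] sHV nHG; have [->|ntH] := eqVneq (H : {set gT}) 1.
  by left.
by right; rewrite (minV H) // ntH.
Qed.

Lemma maximal1_prime M : maximal 1%G M -> prime #|M|.
Proof.
case/maxgroupP=> [/andP[_ ntM] maxM].
have ltM : 1 < #|M| by rewrite cardG_gt1; apply: contraNneq ntM => ->.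
have [x Mx ox] := Cauchy (pdiv_prime ltM) (pdiv_dvd _).
have pr_x : prime #[x] by rewrite ox pdiv_prime.
have sxM : <[x]> \subset M by rewrite cycle_subG.
suff -> : M :=: <[x]> by [].
apply/eqP; rewrite eqEsubset sxM andbT; apply: contraLR pr_x => nsM.
have /maxM/(_ (sub1G _)) x1 : <[x]>%G \proper M by rewrite properE sxM.
by rewrite /order x1 cards1.
Qed.

Lemma faithful_prime_ltn M V :
  M \subset 'N(V) -> prime #|V| -> 'C_M(V) = 1 -> #|M| < #|V|.
Proof.
move=> nVM prV faith; have cycV := prime_cyclic prV.
have injM : #|conj_aut V @* M| = #|M|.
  by rewrite card_morphim /= ker_conj_aut (setIidPr nVM) -indexgI faith indexg1.
have := subset_leq_card (Aut_conj_aut V M).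
rewrite injM card_Aut_cyclic // totient_prime // => leM.
by rewrite (leq_ltn_trans leM) // prednK ?prime_gt0.
Qed.

(** The number of Sylow subgroups is at most [p] and is 1 modulo [p]. *)
Lemma small_index_Sylow_normal p G (S : {group gT}) :
  p.-Sylow(G) S -> prime p -> #|G : S| <= p -> S <| G.
Proof.
move=> sylS pr_p leGS; have sSG := pHall_sub sylS.
have sSN : S \subset 'N_G(S) by rewrite subsetI sSG normG.
have le : #|G : 'N_G(S)| <= p.
  apply: leq_trans leGS; apply: dvdn_leq => //.
  exact: indexgS.
have := card_Syl_mod G pr_p; rewrite (card_Syl sylS).
move: le; rewrite leq_eqVlt => /orP[/eqP->|lt]; first by rewrite modnn.
rewrite modn_small // => /eqP; rewrite indexg_eq1 subsetI => /andP[_ nSG].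
by rewrite /normal sSG.
Qed.

(* Schmidt: if M is a maximal modular subgroup, then G / K, with K the core of
   M, has prime order or is nonabelian of order a * b with b < a primes and
   a = #|G : M|.  Only the numerical part is needed. *)
Definition small_index G M : Prop :=
  prime #|G : M| /\
  exists2 K : {group gT}, (K <| G) && (K \subset M) &
    K :=: M \/ prime #|M : K| /\ #|M : K| < #|G : M|.

Lemma small_index_quo_sol G M :
  M \subset G -> small_index G M ->
  exists2 K : {group gT}, (K <| G) && (K \subset M) & solvable (G / K).
Proof.
move=> sMG [prGM [K /andP[nsKG sKM] cases]]; exists K; first by rewrite nsKG.
apply: (@pi_solvable _ _ #|G : M| #|M : K|) => r pr_r.
rewrite card_quotient ?normal_norm // -(Lagrange_index sMG sKM).
case: cases => [->|[prMK _]].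
  by rewrite indexgg muln1 dvdn_prime2 // => /eqP; left.
by rewrite Euclid_dvdM // !dvdn_prime2 // => /orP[]/eqP; [left | right].
Qed.

Lemma small_index_der1 G M :
  M \proper G -> small_index G M -> G^`(1) != G.
Proof.
case/andP=> sMG nsGM /(small_index_quo_sol sMG)[K /andP[nsKG sKM] solGK].
have ntGK : G / K != 1.
  rewrite -subG1 quotient_sub1 ?normal_norm //.
  by apply: contra nsGM => /subset_trans->.
have := sol_der1_proper solGK (subxx _) ntGK.
rewrite -quotient_der ?normal_norm //.
by apply: contraTneq => ->; rewrite properxx.
Qed.

Lemma gcore1_norm G M L : gcore M G = 1 -> L \subset M -> G \subset 'N(L) -> L :=: 1.
Proof. by move=> core1 sLM nLG; apply/trivgP; rewrite -core1 gcore_max. Qed.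

(** [M] complements [V], and joined with any subgroup of prime order of [V] it gives [G], so
    modularity forces [V] to have prime order. Being core-free, [M] acts faithfully on [V]. *)
Lemma small_index_abelian G M V :
    modular_in G M -> maximal M G -> gcore M G = 1 ->
    minnormal V G -> V \subset G -> abelian V ->
  small_index G M.
Proof.
move=> modM maxM core1 minV sVG abV.
have [/andP[sMG nsGM] _] := maxgroupP maxM.
have [/andP[ntV nVG] _] := mingroupP minV.
have nVM := subset_trans sMG nVG.
have nsVM : ~~ (V \subset M).
  by apply: contra ntV => sVM; apply/eqP/(gcore1_norm core1 sVM nVG).
have joinE W : W \subset G -> ~~ (W \subset M) -> M <*> W = G.
  move=> sWG nsWM; apply/eqP; rewrite eqEsubset join_subG sMG sWG /=.
  apply: contraR nsWM => nsG; have [_ /(_ (M <*> W)%G)] := maxgroupP maxM.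
  rewrite /= properE join_subG sMG sWG joing_subl => /(_ nsG isT) <-.
  exact: joing_subr.
have defG : M * V = G by rewrite -norm_joinEl // joinE.
have tiMV : M :&: V = 1.
  apply: (gcore1_norm core1 (subsetIl M V)); rewrite -defG mul_subG //.
    by rewrite normsI ?normG.
  by rewrite cents_norm // (subset_trans abV) // centS ?subsetIr.
have ltV : 1 < #|V| by rewrite cardG_gt1.
have [v Vv ov] := Cauchy (pdiv_prime ltV) (pdiv_dvd _).
have pr_v : prime #[v] by rewrite ov pdiv_prime.
have sZV : <[v]> \subset V by rewrite cycle_subG.
have nMv : v \notin M.
  apply: contraL pr_v => Mv; have : v \in M :&: V by rewrite inE Mv.
  by rewrite tiMV => /set1P->; rewrite order1.
have defV : V :=: <[v]>.
  rewrite -(modular_joinK modM sVG sZV) ?tiMV ?sub1G //.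
  by rewrite joinE ?cycle_subG ?(subsetP sVG) //; apply/esym/setIidPr.
have prV : prime #|V| by rewrite defV.
have iGM : #|G : M| = #|V|.
  by rewrite -divgS // -defG TI_cardMg // mulKn.
split; first by rewrite iGM.
exists 1%G; first by rewrite normal1 sub1G.
have [M1|ntM] := eqVneq (M : {set gT}) 1; [by left; rewrite M1 | right].
rewrite indexg1 iGM.
have cMV : 'C_M(V) = 1.
  apply: (gcore1_norm core1 (subsetIl _ _)); rewrite -defG mul_subG //.
    by rewrite normsI ?normG // norms_cent.
  by rewrite cents_norm // centsC subsetIr.
split; last exact: faithful_prime_ltn.
have Gv : v \in G by apply: (subsetP sVG).
have nMMv : ~~ (M \subset M :^ v).
  apply: contra ntM => sMMv; apply/eqP/(gcore1_norm core1 (subxx _)).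
  rewrite -defG mul_subG ?normG // defV cycle_subG.
  by rewrite -groupV inE sub_conjgV.
have maxMv : maximal (M :^ v)%G G by rewrite /= -(conjGid Gv) maximalJ.
have := modular_maximalI (modularJ Gv modM) maxMv sMG nMMv.
suff -> : (M :^ v :&: M)%G = 1%G by apply: maximal1_prime.
(* If [w] and [w ^ v] lie in [M], then [[~ w, v]] lies in [M :&: V], so [w] centralises [V]. *)
apply/val_inj/trivgP/subsetP=> m /= /setIP[/imsetP[w Mw ->] Mm].
have Vwv : [~ w, v] \in V by rewrite -groupV invg_comm groupMl ?groupV // memJ_norm ?(subsetP nVM).
have : [~ w, v] \in M :&: V by rewrite inE Vwv andbT /commg groupM ?groupV.
rewrite tiMV => /set1P cwv; rewrite conjg_mulR cwv mulg1 -cMV inE Mw /=.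
by rewrite defV cent_cycle; apply/cent1P/commgP; rewrite cwv.
Qed.

End GroupFacts.

(** If [p] divides [#|M / K|] then, being at least every prime divisor of [#|M|], it equals
    [#|M : D|]. A Sylow p-subgroup of [M / K] then has order [p] and index less than [p], so it is
    normal and contains all p-elements. *)
Lemma small_index_pgen (gT : finGroupType) (M D : {group gT}) (p : nat) :
    prime p -> (forall q, prime q -> q %| #|M| -> q <= p) ->
    D \subset M -> small_index M D ->
  exists2 K : {group gT}, (K <| M) && (K \subset D) &
    p.-group (<<[set x in M | p.-elt x]>> / K) &&
    abelian (<<[set x in M | p.-elt x]>> / K).
Proof.
move=> pr_p maxp sDM [prMD [K /andP[nsKM sKD] cases]].
exists K; first by rewrite nsKM.
have [sKM nKM] := andP nsKM.
have [S sylS] := Sylow_exists p (M / K); have [sSM pS _] := and3P sylS.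
have oMK : #|M / K| = (#|M : D| * #|D : K|)%N.
  by rewrite card_quotient // Lagrange_index.
have [nS abS] : S <| M / K /\ abelian S.
  have [S1|ntS] := eqVneq (S : {set _}) 1; first by rewrite S1 normal1 abelian1.
  have pMK : p %| #|M / K|.
    have [_ pdvS _] := pgroup_pdiv pS ntS; exact: dvdn_trans pdvS (cardSg sSM).
  have ltDK : #|D : K| < #|M : D|.
    by case: cases => [->|[]//]; rewrite indexgg prime_gt1.
  have leMDp : #|M : D| <= p.
    by rewrite maxp // (dvdn_trans (dvdn_indexg _ _)).
  have pMD : #|M : D| = p.
    move: pMK; rewrite oMK Euclid_dvdM // dvdn_prime2 // => /orP[/eqP-> //|].
    by move/(dvdn_leq (indexg_gt0 _ _)) => /leq_ltn_trans/(_ ltDK); rewrite ltnNge leMDp.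
  have oS : #|S| = p.
    rewrite (card_Hall sylS) oMK pMD partnM ?(prime_gt0 pr_p) // part_pnat_id ?pnat_id //.
    rewrite part_p'nat ?muln1 // p'natE //.
    by apply/negP=> /(dvdn_leq (indexg_gt0 _ _)); rewrite leqNgt -pMD ltDK.
  split; last by rewrite cyclic_abelian // prime_cyclic ?oS.
  apply: (small_index_Sylow_normal sylS pr_p).
  rewrite -divgS // oS oMK pMD mulKn ?prime_gt0 //.
  by rewrite ltnW // -pMD.
have sES : <<[set x in M | p.-elt x]>> / K \subset S.
  rewrite sub_quotient_pre; last first.
    by rewrite gen_subG; apply/subsetP=> x; rewrite inE => /andP[/(subsetP nKM)].
  rewrite gen_subG; apply/subsetP=> x; rewrite inE => /andP[Mx px].
  have nKx := subsetP nKM x Mx.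
  by rewrite mem_morphpre // (mem_normal_Hall sylS) ?mem_quotient // morph_p_elt.
by rewrite (pgroupS sES) // (abelianS sES).
Qed.

(** * Maximal modular subgroups of nonabelian simple groups *)

Section SimpleMaximal.

Variables (gT : finGroupType) (G M : {group gT}).
Implicit Types D H X Y : {group gT}.
Hypothesis simG : simple G.
Hypothesis nabG : ~~ abelian G.
Hypothesis modM : modular_in G M.
Hypothesis maxM : maximal M G.
Hypothesis IH : forall X D, X \proper G -> modular_in X D -> maximal D X ->
  small_index X D.

Let sMG : M \subset G.
Proof. exact: modular_sub modM. Qed.

Let nsGM : ~~ (G \subset M).
Proof. by have [/andP[]] := maxgroupP maxM. Qed.

Let pMG : M \proper G.
Proof. by rewrite properE sMG. Qed.

Let maxE H : M \subset H -> H \subset G -> H :=: M \/ H :=: G.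
Proof.
move=> sMH sHG; have [_ max] := maxgroupP maxM.
have [sGH|nsGH] := boolP (G \subset H).
  by right; apply/eqP; rewrite eqEsubset sHG.
by left; rewrite (max H) // properE sHG.
Qed.

Let simE H : H <| G -> ~~ (G \subset H) -> H :=: 1.
Proof.
by have [_ E] := simpleP _ simG; case/E=> // ->; rewrite subxx.
Qed.

Let core_free H : (forall h, h \in G -> H \subset M :^ h) -> H :=: 1.
Proof.
move=> sH; have core1 : gcore M G = 1.
  apply: (@simE (gcore_group M G)); first exact: gcore_normal.
  by apply: contra nsGM => /subset_trans->; rewrite ?gcore_sub.
by apply/trivgP; rewrite -core1; apply/bigcapsP.
Qed.

Let ntM : M :!=: 1.
Proof.
apply: contraNneq nabG => M1; have M1g : M = 1%G by apply/val_inj.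
by rewrite cyclic_abelian // prime_cyclic // maximal1_prime // -M1g.
Qed.

Let normE H : H :!=: 1 -> H \subset M -> M \subset 'N(H) -> 'N_G(H) = M.
Proof.
move=> ntH sHM nHM; have [||//|E] := maxE (H := 'N_G(H)%G).
- by rewrite subsetI sMG.
- exact: subsetIl.
case/eqP: ntH; apply: simE.
  by rewrite /normal (subset_trans sHM) //= -{1}E subsetIr.
by apply: contra nsGM => /subset_trans->.
Qed.

Let normM g : g \in G -> M :^ g = M -> g \in M.
Proof.
by move=> Gg Mg; rewrite -(normE ntM (subxx _) (normG _)) inE Gg; apply/normP.
Qed.

Let max_meet X h : X \proper G -> h \in G -> ~~ (X \subset M :^ h) ->
  maximal (M :^ h :&: X)%G X /\ small_index X (M :^ h :&: X)%G.
Proof.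
move=> pXG Gh nsX; have sXG := proper_sub pXG.
have modMh := modularJ Gh modM.
have maxMh : maximal (M :^ h)%G G by rewrite /= -(conjGid Gh) maximalJ.
have maxX := modular_maximalI modMh maxMh sXG nsX.
split=> //; apply: (IH pXG _ maxX); exact: (modularI sXG modMh).
Qed.

Let nsMM h : h \in G -> h \notin M -> ~~ (M \subset M :^ h).
Proof.
move=> Gh; apply: contra => sMM; apply: normM => //.
by apply/eqP; rewrite eq_sym eqEcard sMM cardJg /=.
Qed.

Let gM : exists2 g, g \in G & g \notin M.
Proof. exact/subsetPn. Qed.

(* The elements of order a power of the largest prime p dividing #|M| form a
   normal abelian Sylow p-subgroup P of M, which turns out to have order p, to meet
   its other conjugates trivially, and to be self-centralising in M. *)
Let p := max_pdiv #|M|.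

Let pr_p : prime p.
Proof. by rewrite max_pdiv_prime ?cardG_gt1. Qed.

Let max_p q : prime q -> q %| #|M| -> q <= p.
Proof. by move=> pr_q qM; rewrite max_pdiv_max // mem_primes pr_q cardG_gt0. Qed.

Let P := <<[set x in M | p.-elt x]>>%G.

Let sPM : P \subset M.
Proof. by rewrite gen_subG; apply/subsetP=> x; rewrite inE => /andP[]. Qed.

Let nPM : M \subset 'N(P).
Proof.
apply/norms_gen/subsetP=> m Mm; rewrite inE; apply/subsetP=> _ /imsetP[x xP ->].
by move: xP; rewrite !inE p_eltJ => /andP[Mx ->]; rewrite groupJ.
Qed.

Let P_quo h : h \in G -> h \notin M ->
  exists2 K : {group gT}, (K <| M) && (K \subset M :^ h :&: M) &
    p.-group (P / K) && abelian (P / K).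
Proof.
move=> Gh nMh; have [_ siMh] := max_meet pMG Gh (nsMM Gh nMh).
by apply: (small_index_pgen pr_p max_p _ siMh); rewrite subsetIr.
Qed.

(** An element of [P] of prime order other than [p] is trivial modulo each [K] from [P_quo], so it
    lies in every conjugate of [M], against [core_free]. The proof of [abP] treats the derived
    subgroup of [P] likewise. *)
Let pP : p.-group P.
Proof.
apply/pgroupP=> q pr_q qP; apply: contraT => neq_qp.
have [y Py oy] := Cauchy pr_q qP.
suff y1 : <[y]> = 1 by move: pr_q; rewrite -oy /order y1 cards1.
apply: core_free => h Gh; rewrite cycle_subG.
have [Mh|nMh] := boolP (h \in M); first by rewrite /= (conjGid Mh) (subsetP sPM).
have [K /andP[nsKM sKD] /andP[pPK _]] := P_quo Gh nMh.
have nKy : y \in 'N(K) by apply: (subsetP (normal_norm nsKM)); apply: (subsetP sPM).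
suff : y \in M :^ h :&: M by case/setIP.
apply: (subsetP sKD); apply: coset_idr => //.
have py : p.-elt (coset K y) by apply: mem_p_elt pPK _; apply: mem_quotient.
have p'y : p^'.-elt (coset K y).
  by apply: morph_p_elt => //; rewrite /p_elt oy pnatE.
have := pnat_1 py p'y. by move/eqP; rewrite order_eq1 => /eqP.
Qed.

Let sylP : p.-Sylow(M) P.
Proof.
have [S sylS] := Sylow_exists p M; have [sSM pS _] := and3P sylS.
have sSP : S \subset P.
  by apply/subsetP=> x Sx; rewrite mem_gen // inE (subsetP sSM) ?(mem_p_elt pS).
by rewrite /= (sub_pHall sylS pP sSP sPM).
Qed.

Let nsPM : P <| M.
Proof. by rewrite /normal sPM. Qed.

Let ntP : P :!=: 1.
Proof.
have [x Mx ox] := Cauchy pr_p (max_pdiv_dvd #|M|).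
apply: contraTneq pr_p => P1; have : x \in P.
  by rewrite mem_gen // inE Mx /p_elt ox pnat_id.
by rewrite P1 => /set1P x1; rewrite -ox x1 order1.
Qed.

Let NP : 'N_G(P) = M.
Proof. exact: normE. Qed.

Let abP : abelian P.
Proof.
apply/derG1P; apply: core_free => h Gh.
have [Mh|nMh] := boolP (h \in M).
  by rewrite /= (conjGid Mh) (subset_trans (der_sub 1 P)).
have [K /andP[nsKM sKD] /andP[_ abPK]] := P_quo Gh nMh.
have nKP := subset_trans sPM (normal_norm nsKM).
apply: subset_trans (der1_min nKP abPK) _.
by apply: subset_trans sKD (subsetIl _ _).
Qed.

Let sub_P (Q : {group gT}) h : Q \subset M :^ h -> p.-group Q -> Q \subset P :^ h.
Proof.
rewrite -!sub_conjgV => sQM pQ.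
by rewrite (sub_normal_Hall sylP nsPM) // pgroupJ.
Qed.

Let nsPMh h : h \in G -> h \notin M -> ~~ (P \subset M :^ h).
Proof.
move=> Gh; apply: contra => /sub_P/(_ pP) sPP.
rewrite -NP inE Gh; apply/normP/eqP.
by rewrite eq_sym eqEcard sPP cardJg /=.
Qed.

Let D h := (M :^ h :&: M)%G.

Let maxD h : h \in G -> h \notin M -> maximal (D h) M /\ small_index M (D h).
Proof. by move=> Gh nMh; apply: max_meet => //; apply: nsMM. Qed.

Let PD h : h \in G -> h \notin M -> P * D h = M.
Proof.
move=> Gh nMh; have nPD : D h \subset 'N(P) by rewrite (subset_trans (subsetIr _ _)).
have [maxDM _] := maxD Gh nMh; have [/andP[sDM _] max] := maxgroupP maxDM.
rewrite -norm_joinEr //; apply/eqP; rewrite eqEsubset join_subG sPM sDM /=.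
apply: contraR (nsPMh Gh nMh) => nsMPD.
apply: subset_trans (subsetIl (M :^ h) M).
rewrite -[_ :&: _](max (P <*> D h)%G _ (joing_subr _ _)) ?joing_subl //.
by rewrite /= properE join_subG sPM sDM.
Qed.

(** [M] is the product of [P], which is abelian, and [D h], which normalises both [P] and
    [P :^ h]. *)
Let nPP h : h \in G -> h \notin M -> M \subset 'N(P :&: P :^ h).
Proof.
move=> Gh nMh; rewrite -(PD Gh nMh) mul_subG //.
  by rewrite cents_norm // centsC (subset_trans (subsetIl _ _)).
rewrite normsI //; first by rewrite (subset_trans (subsetIr _ _)).
by rewrite (subset_trans (subsetIl _ _)) // normJ conjSg.
Qed.

(** If the intersection is nontrivial, its normaliser is [M] by [nPP]; by symmetry [M :^ h]
    normalises it too, so [M :^ h = M]. *)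
Let tiPP h : h \in G -> h \notin M -> P :&: P :^ h = 1.
Proof.
move=> Gh nMh; apply/eqP; apply: contraR (nsMM Gh nMh) => ntR.
have NR := normE (H := (P :&: P :^ h)%G) ntR (subset_trans (subsetIl _ _) sPM) (nPP Gh nMh).
have sMhM : M :^ h \subset M.
  rewrite /= in NR; rewrite -{2}NR subsetI -{1}(conjGid Gh) conjSg sMG /=.
  have := @nPP h^-1; rewrite !groupV => /(_ Gh nMh).
  by rewrite -(conjSg _ _ h) -normJ conjIg -conjsgM mulVg conjsg1 setIC.
have -> : M :^ h = M by apply/eqP; rewrite eqEcard sMhM cardJg /=.
exact: subxx.
Qed.

Let tiPMh h : h \in G -> h \notin M -> P :&: M :^ h = 1.
Proof.
move=> Gh nMh; apply/trivgP; rewrite -(tiPP Gh nMh) subsetI subsetIl /=.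
have := @sub_P (P :&: M :^ h)%G h (subsetIr _ _); apply.
exact: pgroupS (subsetIl _ _) pP.
Qed.

Let tiPD h : h \in G -> h \notin M -> P :&: D h = 1.
Proof. by move=> Gh nMh; rewrite /= setIA tiPMh // setI1g. Qed.

Let oP : #|P| = p.
Proof.
have [g Gg nMg] := gM; have [_ [prMD _]] := maxD Gg nMg.
have sDM : D g \subset M by apply: subsetIr.
have : #|M : D g| = #|P|.
  by rewrite -divgS // -{1}(PD Gg nMg) (TI_cardMg (tiPD Gg nMg)) mulnK.
move=> E; rewrite E in prMD.
have [_ pdvP _] := pgroup_pdiv pP ntP.
by move: pdvP; rewrite dvdn_prime2 // => /eqP.
Qed.

Let oM h : h \in G -> h \notin M -> #|M| = (p * #|D h|)%N.
Proof. by move=> Gh nMh; rewrite -(PD Gh nMh) (TI_cardMg (tiPD Gh nMh)) oP. Qed.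

Let p'D h : h \in G -> h \notin M -> p^'.-group (D h).
Proof.
move=> Gh nMh; have [_ _] := and3P sylP.
by rewrite -divgS // oP (oM Gh nMh) mulKn ?prime_gt0.
Qed.

(** Write [k = u * d] with [u] in [P] and [d] in [D i]. Since [k] centralises [P], [u] is a product
    of commuting p'-elements [k] and [d^-1], hence trivial, and [k] lies in [M :^ i]. *)
Let cDP h : h \in G -> h \notin M -> 'C_(D h)(P) = 1.
Proof.
move=> Gh nMh; apply: core_free => i Gi; apply/subsetP=> k /setIP[Dk cPk].
have Mk : k \in M by case/setIP: Dk.
have [Mi|nMi] := boolP (i \in M); first by rewrite (conjGid Mi).
have : k \in P * D i by rewrite PD.
case/mulsgP=> u d Pu Dd defk.
have cuk : commute u k by apply/esym; apply: (centP cPk).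
have defu : u = k * d^-1 by rewrite defk mulgK.
have defd : d = u^-1 * k by rewrite defk mulKg.
have ckd : commute k d^-1.
  by apply: commuteV; rewrite defd; apply: commuteM => //; apply: commuteV; apply: commute_sym.
have p'u : p^'.-elt u.
  rewrite defu p_eltM // ?p_eltV.
    exact: mem_p_elt (p'D Gh nMh) Dk.
  exact: mem_p_elt (p'D Gi nMi) Dd.
have := pnat_1 (mem_p_elt pP Pu) p'u => /eqP; rewrite order_eq1 => /eqP u1.
by rewrite defk u1 mul1g; case/setIP: Dd.
Qed.

(** [K] is normal in [M] and meets [P] trivially, so it centralises [P] and is trivial by [cDP]. *)
Let oD h : h \in G -> h \notin M -> D h :=: 1 \/ prime #|D h| /\ #|D h| < p.
Proof.
move=> Gh nMh; have [_ [_ [K /andP[nsKM sKD] cases]]] := maxD Gh nMh.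
have tiKP : [~: K, P] = 1.
  apply/trivgP; rewrite -(tiPD Gh nMh) setIC.
  apply: subset_trans (setSI _ sKD); apply: commg_subI.
    by rewrite subsetI subxx (subset_trans (normal_sub nsKM)).
  by rewrite subsetI subxx (subset_trans sPM) ?normal_norm.
have K1 : K :=: 1.
  by apply/trivgP; rewrite -(cDP Gh nMh) subsetI sKD; apply/commG1P.
have iMD : #|M : D h| = p.
  by rewrite -divgS ?subsetIr // (oM Gh nMh) mulnK.
by move: cases; rewrite K1 indexg1 iMD; case=> [<-|]; [left | right].
Qed.

Let oD_const g h : g \in G -> g \notin M -> h \in G -> h \notin M -> #|D g| = #|D h|.
Proof.
move=> Gg nMg Gh nMh; have := oM Gg nMg; rewrite (oM Gh nMh) => /eqP.
by rewrite eqn_pmul2l ?prime_gt0 // => /eqP->.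
Qed.

(* Otherwise M is a Frobenius complement in G. *)
Let ntD g : g \in G -> g \notin M -> D g :!=: 1.
Proof.
move=> Gg nMg; apply/eqP=> D1.
have tiMh h : h \in G -> h \notin M -> M :^ h :&: M = 1.
  by move=> Gh nMh; apply: card1_trivg; rewrite (oD_const Gh nMh Gg nMg) D1 cards1.
have frobG : [Frobenius G with complement M].
  rewrite /Frobenius_group_with_complement; apply/andP; split.
    by apply: contraNneq nsGM => <-.
  apply/normedTI_P; split.
  - by rewrite setD_eq0 subG1.
  - by rewrite subsetI sMG normD1 normG.
  move=> h Gh; apply: contraR => nMh.
  by rewrite -setI_eq0 conjD1g -setDIl setIC tiMh // setDv.
have [K frobK] := Frobenius_kernel_exists frobG.
have [defG ntK _ pKG _] := Frobenius_context frobK.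
have [nsKG _ _ _ _] := sdprod_context defG.
by case/eqP: ntK; apply: simE => //; apply: proper_subn.
Qed.

Let prD g : g \in G -> g \notin M -> prime #|D g| /\ #|D g| < p.
Proof. by move=> Gg nMg; case: (oD Gg nMg) => // /eqP; rewrite (negPf (ntD Gg nMg)). Qed.

(* Now M has order p * s and D := D g has prime order s.  The normaliser X of D
   has order s * f with f prime; a conjugate of M not containing D meets X in a
   subgroup of prime index, which forces f = s.  Then N_G(X) is larger than X and
   meets M in a subgroup of prime index, hence contains M. *)
Lemma simple_modular_maximal_contra : False.
Proof.
have [g Gg nMg] := gM; have [] := prD Gg nMg.
set s := #|D g| => pr_s lt_sp.
have oMs : #|M| = (p * s)%N := oM Gg nMg.
have sDM : D g \subset M := subsetIr _ _.
have neq_sp : s != p by rewrite neq_ltn lt_sp.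
have Hs (Q Y : {group gT}) : #|Y| = (p * s)%N -> Q \subset Y -> #|Q| = s -> s.-Sylow(Y) Q.
  move=> oY sQY oQ; rewrite pHallE sQY oQ oY partnM ?prime_gt0 //= part_p'nat ?mul1n.
    by rewrite part_pnat_id ?pnat_id.
  by rewrite pnatE // !inE eq_sym.
have sylD := Hs (D g) M oMs sDM erefl.
have [maxDM _] := maxD Gg nMg.
pose X := 'N_G(D g)%G.
have nDX : X \subset 'N(D g) by apply: subsetIr.
have sDX : D g \subset X by rewrite subsetI normG (subset_trans sDM).
have sXG : X \subset G := subsetIl _ _.
have nGD : ~~ (G \subset 'N(D g)).
  apply: contra (ntD Gg nMg) => nDG; apply/eqP/simE.
    by rewrite /normal (subset_trans sDM).
  by apply: contra nsGM => /subset_trans->.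
have pXG : X \proper G.
  by rewrite properE sXG; apply: contra nGD => /subset_trans->.
(* [D g] is maximal in [M], hence self-normalising or normal; if normal it would centralise [P]. *)
have NMD : 'N_M(D g) = D g.
  have [//|E] : 'N_M(D g) = D g \/ M \subset 'N(D g).
    have [/andP[_ _] max] := maxgroupP maxDM.
    have [nDM|nDM] := boolP (M \subset 'N(D g)); [by right | left].
    apply: (max 'N_M(D g)%G); last by rewrite /= subsetI sDM normG.
    by rewrite properE subsetIl; apply: contra nDM; rewrite subsetI => /andP[].
  have cDgP : [~: D g, P] = 1.
    rewrite commGC; apply/trivgP; rewrite -(tiPD Gg nMg); apply: commg_subI.
      by rewrite subsetI subxx (subset_trans sPM).
    by rewrite subsetI subxx (subset_trans sDM).
  case/eqP: (ntD Gg nMg); apply/trivgP; rewrite -(cDP Gg nMg) subsetI subxx /=.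
  exact/commG1P.
(* [D g] and its conjugate by [g^-1] are Sylow in [M], hence conjugate under some [m] in [M]; take
   [y = g^-1 * m]. *)
have [y Xy nMy] : exists2 y, y \in X & y \notin M.
  have sDgM : D g :^ g^-1 \subset M by rewrite -(conjSg _ _ g) -conjsgM mulVg conjsg1 subsetIl.
  have sylDg := Hs (D g :^ g^-1)%G M oMs sDgM (cardJg _ _).
  have [m Mm defD] := Sylow_trans sylDg sylD.
  exists (g^-1 * m); last by rewrite groupMr // groupV.
  rewrite inE groupM ?groupV ?(subsetP sMG m) //=; apply/normP.
  by rewrite conjsgM -defD.
have nsXM : ~~ (X \subset M) by apply/subsetPn; exists y.
have DIM : M :&: X = D g.
  by rewrite /= setIA (setIidPl sMG) NMD.
have [_ [prXD _]] : maximal (D g) X /\ small_index X (D g).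
  have := @max_meet X 1 pXG (group1 G); rewrite conjsg1 => /(_ nsXM).
  suff -> : (M :^ 1 :&: X)%G = D g by [].
  by apply/val_inj; rewrite /= conjsg1.
have [h Gh nsDh] : exists2 h, h \in G & ~~ (D g \subset M :^ h).
  apply/exists_inP; apply: contraR (ntD Gg nMg); rewrite negb_exists_in => /forall_inP sD.
  by apply/eqP/core_free => h /sD; rewrite negbK.
have nsXh : ~~ (X \subset M :^ h) by apply: contra nsDh => /(subset_trans sDX).
have [_ [prXD1 _]] := max_meet pXG Gh nsXh.
set D1 := (M :^ h :&: X)%G in prXD1.
have sD1X : D1 \subset X := subsetIr _ _.
have sD1M : D1 \subset M :^ h := subsetIl _ _.
have D1dvd : #|D1| %| p * s by rewrite -oMs -(cardJg M h) cardSg.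
have oX : #|X| = (s * #|X : D g|)%N by rewrite (Lagrange sDX).
have oX1 : (#|D1| * #|X : D1|)%N = (s * #|X : D g|)%N by rewrite (Lagrange sD1X).
have nsDX : D g <| X by rewrite /normal sDX.
have nsDD1 : ~~ (D g \subset D1) by apply: contra nsDh => /subset_trans->.
(* Otherwise [D g] is the normal Sylow s-subgroup of [X] and [D1] has order [p]. As [s < p], [D1]
   centralises [D g]; but [D1] is [P :^ h], whose normaliser is [M :^ h], so [D g] would lie in
   [M :^ h]. *)
have fs : #|X : D g| = s.
  apply/eqP; apply: contraR (nsDD1) => neq_fs.
  have sylDX : s.-Sylow(X) (D g).
    by rewrite /pHall sDX (pHall_pgroup sylD) pnatE.
  have neqD1 : #|D1| != s.
    apply: contra (nsDD1) => /eqP oD1.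
    have sD1D : D1 \subset D g.
      by rewrite (sub_normal_Hall sylDX nsDX) // /pgroup oD1 pnat_id.
    suff -> : D1 = D g by [].
    by apply/val_inj/eqP; rewrite /= eqEcard sD1D oD1 /=.
  have oD1 : #|D1| = #|X : D g|.
    have : #|X : D1| %| s * #|X : D g| by rewrite -oX1 dvdn_mull.
    rewrite Euclid_dvdM // !dvdn_prime2 // => /orP[]/eqP Eu.
      by apply/eqP; rewrite -(eqn_pmul2l (prime_gt0 pr_s)) -oX1 Eu mulnC.
    case/eqP: neqD1; apply/eqP.
    by rewrite -(eqn_pmul2r (prime_gt0 prXD)) -oX1 Eu.
  have oD1p : #|D1| = p.
    move: D1dvd; rewrite oD1 Euclid_dvdM // !dvdn_prime2 // (negPf neq_fs) orbF.
    by move/eqP.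
  have prD1 : prime #|D1| by rewrite oD1p.
  have nDD1 := subset_trans sD1X nDX.
  have sD1C : D1 \subset 'C(D g).
    apply: (prime_meetG prD1); apply: contraTneq lt_sp => faith.
    by rewrite -leqNgt -oD1p ltnW // (faithful_prime_ltn nDD1).
  have defD1 : D1 :=: P :^ h.
    apply/eqP; rewrite eqEcard cardJg oP oD1p leqnn andbT.
    by apply: sub_P => //; rewrite /pgroup oD1p pnat_id.
  case/negP: nsDh; rewrite -NP conjIg (conjGid Gh) subsetI (subset_trans sDX) //=.
  by rewrite -normJ -defD1 cents_norm // centsC.
have us : #|X : D1| = s.
  have : #|X : D1| %| s * #|X : D g| by rewrite -oX1 dvdn_mull.
  by rewrite fs Euclid_dvdM // dvdn_prime2 // orbb => /eqP.
have oD1 : #|D1| = s.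
  by apply/eqP; rewrite -(eqn_pmul2r (prime_gt0 pr_s)) -{1}us oX1 fs.
have abX : abelian X.
  by apply: (@card_p2group_abelian _ s) => //; rewrite oX fs.
have oMh : #|(M :^ h)%G| = (p * s)%N by rewrite cardJg.
have sDMh : (D g :^ h)%G \subset M :^ h by rewrite conjSg.
(* Sylow's theorem in [M :^ h] gives [z] conjugating [D g] to [D1]. The abelian group [X] normalises
   [D1], so [X] lies in, and equals, [X :^ z]. *)
have [m Mm defD1] := Sylow_trans (Hs _ _ oMh sDMh (cardJg _ _)) (Hs _ _ oMh sD1M oD1).
have Gm : m \in G by apply: subsetP Mm; rewrite -(conjGid Gh) conjSg.
pose z := h * m; have Gz : z \in G by rewrite groupM.
have {}defD1 : D1 :=: D g :^ z by rewrite defD1 conjsgM.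
have defX : X :=: X :^ z.
  apply/eqP; rewrite eqEcard cardJg leqnn andbT /= conjIg (conjGid Gz).
  rewrite subsetI subsetIl -normJ -defD1 cents_norm //.
  exact: subset_trans abX (centS sD1X).
pose Y := 'N_G(X)%G.
have sYG : Y \subset G := subsetIl _ _.
have sXY : X \subset Y by rewrite subsetI sXG normG.
have Yz : z \in Y by rewrite inE Gz; apply/normP.
have nXz : z \notin X.
  apply: contra (nsDD1) => Xz; rewrite defD1.
  by rewrite (normP (subsetP nDX z Xz)).
have pYG : Y \proper G.
  rewrite properE sYG; apply: contra (ntD Gg nMg) => sGY.
  have X1 : X :=: 1.
    apply: simE; last exact: proper_subn.
    by rewrite /normal sXG (subset_trans sGY) ?subsetIr.
  by rewrite -subG1 -X1.
have nsYM : ~~ (Y \subset M) by apply: contra nsXM; apply: subset_trans.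
have [_ []] : maximal (M :^ 1 :&: Y)%G Y /\ small_index Y (M :^ 1 :&: Y)%G.
  by apply: max_meet => //; rewrite conjsg1.
rewrite /= conjsg1; set C := M :&: Y => prYC _.
have sCM : C \subset M := subsetIl _ _.
have sCY : C \subset Y := subsetIr _ _.
have oY : (#|C| * #|Y : C|)%N = (s * s * #|Y : X|)%N.
  by rewrite (Lagrange sCY) -(Lagrange sXY) oX fs.
have Cdvd : #|C| %| p * s by rewrite -oMs cardSg.
(* Otherwise [s * s] divides [#|C|], hence [p * s], which forces [s = p]. *)
have Ys : #|Y : C| = s.
  apply/eqP; apply: contraR neq_sp => neqs.
  rewrite -dvdn_prime2 // -(dvdn_pmul2r (prime_gt0 pr_s)) (dvdn_trans _ Cdvd) //.
  have co : coprime (s * s) #|Y : C|.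
    by rewrite coprimeMl andbb prime_coprime // dvdn_prime2 // eq_sym.
  by rewrite -(Gauss_dvdl _ co) oY dvdn_mulr.
have oC : #|C| = (s * #|Y : X|)%N.
  by apply/eqP; rewrite -(eqn_pmul2r (prime_gt0 pr_s)) -{1}Ys oY mulnAC.
move: Cdvd; rewrite oC mulnC dvdn_pmul2r ?prime_gt0 // => kp.
have : #|Y : X| != 1%N.
  by rewrite indexg_eq1; apply: contra nXz => /subsetP; apply.
have /primeP[_ /(_ _ kp)] := pr_p; case/orP=> [->//|/eqP k _].
have sMY : M \subset Y.
  have : C == M :> {set gT} by rewrite eqEcard sCM oC k oMs mulnC leqnn.
  by move/eqP <-.
have [defY|defY] := maxE sMY sYG; first by rewrite -defY subxx in nsYM.
by move: pYG; rewrite defY properxx.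
Qed.

End SimpleMaximal.

(** Induction on [#|G|], dividing out the core of [M]. If [M] is core-free and [V] is a nonabelian
    minimal normal subgroup, then either [V = G] is simple, which is excluded, or induction in [V]
    gives a solvable quotient, although [V] is perfect by minimality. *)
Lemma modular_maximal_small_index (gT : finGroupType) (G M : {group gT}) :
  modular_in G M -> maximal M G -> small_index G M.
Proof.
have [n] := ubnP #|G|; elim: n => // n IHn in gT G M *.
move=> leGn modM maxM; have sMG := modular_sub modM.
have [_ nsGM] := andP (maxgroupp maxM).
set K0 := [group of gcore M G]; have nsK0G : K0 <| G := gcore_normal sMG.
have sK0M : K0 \subset M := gcore_sub _ _.
have nsK0M : K0 <| M := normalS sK0M sMG nsK0G.
have [core1|ntK0] := eqVneq (K0 : {set gT}) 1; last first.
  have lt : #|G / K0| < n.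
    by rewrite -ltnS (leq_trans _ leGn) // ltnS ltn_quotient // normal_sub.
  have := IHn _ (G / K0)%G (M / K0)%G lt (quotient_modular nsK0G modM).
  rewrite /= quotient_maximal // => /(_ maxM)[].
  rewrite index_quotient_eq ?subIset ?sK0M ?orbT ?normal_norm //=.
  move=> prGM [K /andP[nsK sKM] cases]; split=> //.
  have [H defK sK0H nsHG] := inv_quotientN nsK0G nsK; exists H.
    rewrite nsHG -(quotientSGK _ sK0M) -?defK //.
    by rewrite (subset_trans (normal_sub nsHG)) ?normal_norm.
  have nsK0H := normalS sK0H (normal_sub nsHG) nsK0G.
  have sHM : H \subset M.
    rewrite -(quotientSGK _ sK0M) -?defK //.
    by rewrite (subset_trans (normal_sub nsHG)) ?normal_norm.
  move: cases; rewrite defK index_quotient_eq ?subIset ?sK0H ?orbT ?(normal_norm nsK0M) //.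
  by case=> [/(quotient_inj nsK0H nsK0M)|]; [left | right].
have ntG : G :!=: 1 by apply: contraNneq nsGM => ->; apply: sub1G.
have [V minV sVG] := minnormal_exists ntG (normG G).
have [abV|nabV] := boolP (abelian V).
  exact: small_index_abelian core1 minV sVG abV.
have [/andP[ntV nVG] _] := mingroupP minV.
have IH (X D : {group gT}) : X \proper G -> modular_in X D -> maximal D X -> small_index X D.
  by move=> pXG; apply: IHn; rewrite -ltnS (leq_trans _ leGn) // ltnS proper_card.
have [pVG|] := boolP (V \proper G); last first.
  rewrite properE sVG negbK => sGV.
  have defG : V = G by apply/val_inj/eqP; rewrite eqEsubset sVG.
  rewrite {}defG in nabV minV.
  suff simG : simple G by case: (simple_modular_maximal_contra simG nabV modM maxM IH).
  apply/simpleP; split=> // H /andP[sHG nHG].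
  exact: (minnormal_sub_eq minV).
have nsVM : ~~ (V \subset M).
  by apply: contra ntV => sVM; apply/eqP/(gcore1_norm core1 sVM nVG).
have maxV := modular_maximalI modM maxM sVG nsVM.
have siV := IH _ _ pVG (modularI sVG modM) maxV.
have /eqP[] := small_index_der1 (maxgroupp maxV) siV.
have [| |V1|//] := minnormal_sub_eq minV (H := V^`(1)%G).
- exact: der_sub.
- exact: gFnorm_trans.
by case/negP: nabV; apply/derG1P.
Qed.

(** The factors of a product of elements of [A] and [B] are moved past [Y] one at a time; this gives
    one inclusion, and counting gives equality. *)
Lemma commute_joing (gT : finGroupType) (A B Y : {group gT}) :
  commute A Y -> commute B Y -> commute (A <*> B) Y.
Proof.
move=> cAY cBY.
have sub : (A <*> B) * Y \subset Y * (A <*> B).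
  apply/subsetP=> _ /mulsgP[u y ABu Yy ->].
  have : y \in Y * (A <*> B) by rewrite -[y]mulg1 mem_mulg.
  have /gen_prodgP[m [c ABc ->]] := ABu.
  elim/big_rec: _ => [|i v _ IHv] // Uy; first by rewrite mul1g.
  rewrite -mulgA; move/IHv: Uy => /mulsgP[z w Yz ABw ->].
  have [C sC [cCY Cc]] : exists2 C : {group gT}, C \subset A <*> B & commute C Y /\ c i \in C.
    by case/setUP: (ABc i) => ?; [exists A | exists B]; rewrite ?joing_subl ?joing_subr.
  have : c i * z \in Y * C by rewrite -cCY mem_mulg.
  case/mulsgP=> z' c' Yz' Cc' E.
  by rewrite mulgA E -mulgA mem_mulg // groupM // (subsetP sC).
apply/eqP; rewrite eqEcard sub /=.
rewrite -(leq_pmul2r (cardG_gt0 (Y :&: (A <*> B)))).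
by rewrite -mul_cardG (mulnC #|Y|) mul_cardG [_ :&: Y]setIC.
Qed.

(** * Arbitrary modular subgroups of nonabelian simple groups *)

Section SimpleModular.

Variables (gT : finGroupType) (G A : {group gT}).
Hypothesis simG : simple G.
Hypothesis nabG : ~~ abelian G.
Hypothesis modA : modular_in G A.
Hypothesis ntA : A :!=: 1.
Hypothesis pAG : A \proper G.

Let simE (H : {group gT}) : H <| G -> H :=: 1 \/ H :=: G.
Proof. by have [_ E] := simpleP _ simG; apply: E. Qed.

Let nsolG : ~~ solvable G.
Proof.
apply: contra nabG => solG.
by rewrite cyclic_abelian // prime_cyclic // simple_sol_prime.
Qed.

Let gen_order l : prime l -> l %| #|G| -> G :=: <<[set x in G | #[x] == l]>>.
Proof.
move=> pr_l lG; pose H := <<[set x in G | #[x] == l]>>%G.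
have sHG : H \subset G by rewrite gen_subG; apply/subsetP=> x; rewrite inE => /andP[].
have [|H1|->//] := simE (H := H).
  rewrite /normal sHG norms_gen //; apply/subsetP=> g Gg; rewrite inE.
  apply/subsetP=> _ /imsetP[x xH ->]; move: xH; rewrite !inE orderJ.
  by case/andP=> Gx ->; rewrite groupJ.
have [x Gx ox] := Cauchy pr_l lG.
have : x \in H by rewrite mem_gen // inE Gx ox eqxx.
by rewrite H1 => /set1P x1; rewrite x1 order1 in ox; rewrite -ox in pr_l.
Qed.

Let join_index x : x \in G -> prime #[x] -> x \notin A ->
  small_index (A <*> <[x]>)%G A.
Proof.
move=> Gx pr_x nAx; set B := (A <*> <[x]>)%G.
have sBG : B \subset G by rewrite join_subG (modular_sub modA) cycle_subG.
apply: modular_maximal_small_index.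
  have := modularI sBG modA; suff -> : (A :&: B)%G = A by [].
  by apply/val_inj/setIidPl/joing_subl.
exact: (modular_prime_maximal modA).
Qed.

Let t := max_pdiv #|A|.

Let pr_t : prime t.
Proof. by rewrite max_pdiv_prime ?cardG_gt1. Qed.

Let pgen (H : {group gT}) := <<[set x in H | t.-elt x]>>.

Let norm_pgen (H : {group gT}) : 'N(H) \subset 'N(pgen H).
Proof.
apply/norms_gen/subsetP=> m Nm; rewrite inE; apply/subsetP=> _ /imsetP[x xP ->].
by move: xP; rewrite !inE p_eltJ => /andP[Mx ->]; rewrite memJ_norm // Mx.
Qed.

(* An element of order l that does not normalise the characteristic subgroup
   pgen A of A forces the core of A in <A, x> to have index t in A. *)
Let leq_t l : prime l -> l %| #|G| -> t <= l.
Proof.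
move=> pr_l lG; have sAG := modular_sub modA.
have [nEG|/subsetPn[x]] := boolP ([set x in G | #[x] == l] \subset 'N(pgen A)).
  have nEG' : G \subset 'N(pgen A) by rewrite {1}(gen_order pr_l lG) gen_subG.
  have sEA : pgen A \subset A.
    by rewrite gen_subG; apply/subsetP=> x; rewrite inE => /andP[].
  have nsEG : pgen A <| G by rewrite /normal nEG' (subset_trans sEA).
  have [E1|EG] := simE (H := [group of pgen A]) nsEG; last first.
    by case/negP: (proper_subn pAG); rewrite -EG.
  have [x Ax ox] := Cauchy pr_t (max_pdiv_dvd #|A|).
  have : x \in pgen A by rewrite mem_gen // inE Ax /p_elt ox pnat_id.
  rewrite [pgen A]E1 => /set1P x1.
  by move: pr_t; rewrite -ox x1 order1.
rewrite inE => /andP[Gx /eqP ox] nEx.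
have pr_x : prime #[x] by rewrite ox.
have nAx : x \notin A.
  apply: contra nEx; apply: subsetP; apply: subset_trans (norm_pgen A).
  exact: normG.
set B := (A <*> <[x]>)%G.
have Bx : x \in B by rewrite mem_gen // inE cycle_id orbT.
have sAB : A \subset B := joing_subl _ _.
have [prBA [K /andP[nsKB sKA]]] := join_index Gx pr_x nAx.
have nKx : x \in 'N(K) := subsetP (normal_norm nsKB) x Bx.
case=> [KA|[prAK ltAK]].
  case/negP: nEx; apply: (subsetP (norm_pgen A)).
  by rewrite -KA.
have nKA : A \subset 'N(K) := subset_trans sAB (normal_norm nsKB).
have oAK : #|A / K| = #|A : K| by rewrite card_quotient.
have tAK : #|A : K| = t.
  apply/eqP; apply: contraR nEx => neq.
  suff -> : pgen A = pgen K by apply: (subsetP (norm_pgen K)).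
  apply/eqP; rewrite eqEsubset !genS //; apply/subsetP=> y; rewrite !inE.
    by case/andP=> /(subsetP sKA)->.
  case/andP=> Ay ty; rewrite ty andbT.
  have nKy := subsetP nKA y Ay; apply: coset_idr => //.
  have tKy : t.-elt (coset K y) by apply: morph_p_elt.
  apply/eqP; rewrite -order_eq1; apply/eqP/(pnat_1 tKy).
  apply: pnat_dvd (order_dvdG (mem_quotient K Ay)) _.
  by rewrite oAK pnatE // inE.
have: #[coset K x] %| #|B / K| by rewrite order_dvdG // mem_quotient.
rewrite card_quotient ?normal_norm // -(Lagrange_index sAB sKA) tAK.
have -> : #[coset K x] = l.
  have := morph_order (coset_morphism K) nKx; rewrite ox => dvd_l.
  have [_ /(_ _ dvd_l)/orP[|/eqP//]] := primeP pr_l.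
  rewrite order_eq1 => /eqP/(coset_idr nKx) Kx.
  by rewrite (subsetP sKA) in nAx.
rewrite Euclid_dvdM // !dvdn_prime2 // => /orP[]/eqP-> //.
by rewrite -tAK ltnW.
Qed.

(** [t] is the largest prime divisor of [#|A|] and, by [leq_t], is at most every prime divisor of
    [#|G|]. *)
Let tA : t.-group A.
Proof.
apply/pgroupP=> q pr_q qA; rewrite !inE eqn_leq max_pdiv_max.
  by rewrite leq_t // (dvdn_trans qA) // cardSg ?(modular_sub modA).
by rewrite mem_primes pr_q cardG_gt0.
Qed.

Let ex_prime : exists2 l, prime l & (l %| #|G|) && (l != t).
Proof.
have [tG|] := boolP (t.-group G).
  by case/negP: nsolG; apply: pgroup_sol tG.
rewrite /pgroup /pnat cardG_gt0 /=; case/allPn=> l.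
rewrite mem_primes => /and3P[pr_l _ lG] nlt; exists l => //.
by rewrite lG.
Qed.

(** The index of [A] in the join is prime, and is [l] because [A] is a t-group; so [A * <[x]>] has
    the order of the join. *)
Let join_commute l x : prime l -> l != t -> x \in G -> #[x] = l -> commute A <[x]>.
Proof.
move=> pr_l neq_lt Gx ox; have pr_x : prime #[x] by rewrite ox.
have tiAx : A :&: <[x]> = 1.
  apply: coprime_TIg; rewrite (pnat_coprime tA) // [#|_|]ox pnatE //.
have nAx : x \notin A.
  apply: contraL pr_x => Ax; have : x \in A :&: <[x]> by rewrite inE Ax cycle_id.
  by rewrite tiAx => /set1P->; rewrite order1.
have [prBA _] := join_index Gx pr_x nAx.
set B := (A <*> <[x]>)%G in prBA.
have sAB : A \subset B := joing_subl _ _.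
have sxB : <[x]> \subset B := joing_subr _ _.
have BA : #|B : A| = l.
  have : l %| #|B| by rewrite -ox order_dvdG // -cycle_subG.
  rewrite -(Lagrange sAB) Euclid_dvdM // => /orP[lA|]; last first.
    by rewrite dvdn_prime2 // => /eqP.
  have := pgroupP tA l pr_l lA; rewrite inE /=.
  by rewrite (negPf neq_lt).
apply/comm_group_setP.
suff -> : A * <[x]> = B by apply: groupP.
apply/eqP; rewrite eqEcard mul_subG //= (TI_cardMg tiAx).
by rewrite -(Lagrange sAB) BA [#|<[x]>|]ox.
Qed.

(* Kegel: a maximal {t, l}-subgroup permuting with all subgroups of order l is
   normalised by them, since it absorbs its conjugates under them. *)
Lemma simple_modular_contra : False.
Proof.
have [l pr_l /andP[lG neq_lt]] := ex_prime.
pose gP := [pred X : {group gT} | [&& X \subset G, [pred q | (q == t) || (q == l)].-group X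
  & [forall x in G, (#[x] == l) ==> (X * <[x]> == <[x]> * X)]]].
have gPA : gP A.
  rewrite /= (modular_sub modA) /=; apply/andP; split.
    by apply: sub_in_pnat tA => q _ /eqP ->; rewrite !inE eqxx.
  apply/forall_inP=> x Gx; apply/implyP=> /eqP ox; apply/eqP.
  exact: join_commute ox.
have [X /maxgroupP[/and3P[sXG pX /forall_inP cX] maxX] sAX] := maxgroup_exists gPA.
have comm x : x \in G -> #[x] = l -> commute X <[x]>.
  by move=> Gx ox; apply/eqP; move/(_ x Gx): cX; rewrite ox eqxx.
have nXG : G \subset 'N(X).
  rewrite (gen_order pr_l lG) gen_subG; apply/subsetP=> x.
  rewrite inE => /andP[Gx /eqP ox].
  have sXx : X :^ x \subset X <*> <[x]>.
    have xXx : x \in X <*> <[x]> by rewrite mem_gen // inE cycle_id orbT.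
    by rewrite sub_conjg conjGid ?groupV // joing_subl.
  suff E : X <*> X :^ x = X by rewrite inE -{2}E joing_subr.
  apply: (maxX (X <*> X :^ x)%G); last exact: joing_subl.
  apply/and3P; split.
  - by rewrite join_subG sXG -(conjGid Gx) conjSg.
  - have sXXx : X <*> X :^ x \subset X <*> <[x]> by rewrite join_subG joing_subl.
    apply: pgroupS sXXx _; rewrite /= comm_joingE ?pgroupM ?pX; last exact: comm.
    by rewrite /pgroup [#|_|]ox pnatE // !inE eqxx orbT.
  apply/forall_inP=> y Gy; apply/implyP=> /eqP oy; apply/eqP.
  apply: (@commute_joing _ X (X :^ x)%G <[y]>%G); first exact: comm.
  rewrite /commute /= -[<[y]>](conjsgKV x) -!conjsMg -cycleJ.
  by rewrite comm ?orderJ // groupJ ?groupV.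
have nsXG : X <| G by rewrite /normal sXG.
(* [X] contains [A], so it is not trivial; if it were [G], only [t] and [l] could divide [#|G|],
   against nonsolvability. *)
have [X1|XG] := simE nsXG.
  by case/negP: ntA; rewrite -subG1 -X1.
case/negP: nsolG; apply: (@pi_solvable _ _ t l) => r pr_r rG.
have /pgroupP/(_ r pr_r) := pX; rewrite XG => /(_ rG).
by rewrite !inE => /orP[]/eqP; [left | right].
Qed.

End SimpleModular.

(** * Cover and avoidance *)

Section MoreGroupFacts.

Variable gT : finGroupType.
Implicit Types G H K L M N T X Y Z : {group gT}.

Lemma p_elt_notin G H : ~~ (G \subset H) ->
  exists p : nat, exists2 x, x \in G & p.-elt x && (x \notin H).
Proof.
case/subsetPn=> x Gx nHx.
have [/allP sxH|/allPn[p _ nHp]] := boolP (all (fun p : nat => x.`_p \in H) (index_iota 0 #[x].+1)).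
  case/negP: nHx; rewrite -(prod_constt x) big_seq.
  by apply: group_prod => p /sxH.
exists p, x.`_p; last by rewrite p_elt_constt.
by apply: subsetP (cycle_constt p x); rewrite cycle_subG.
Qed.

Lemma p_elt_cycle_chain (p : nat) x X Y :
  p.-elt x -> X \subset <[x]> -> Y \subset <[x]> -> (X \subset Y) || (Y \subset X).
Proof.
move=> px sX sY; have pX : p.-group <[x]> by [].
rewrite -(cardSg_cyclic (cycle_cyclic x)) // -(cardSg_cyclic (cycle_cyclic x) sY) //.
have [i ->] := p_natP (pgroupS sX pX); have [j ->] := p_natP (pgroupS sY pX).
by have [/dvdn_exp2l->|/ltnW/dvdn_exp2l->] := leqP i j; rewrite ?orbT.
Qed.

Lemma chain_cyclic T :
    (forall X Y, X \subset T -> Y \subset T -> (X \subset Y) || (Y \subset X)) ->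
  cyclic T.
Proof.
move=> chain; pose z := [arg max_(z > 1 in T) #[z]].
have [Tz maxz] : z \in T /\ forall y, y \in T -> #[y] <= #[z].
  by rewrite /z; case: arg_maxnP => // w Tw maxw.
apply/cyclicP; exists z; apply/eqP; rewrite eqEsubset cycle_subG Tz andbT.
apply/subsetP=> y Ty; have := chain <[y]>%G <[z]>%G; rewrite !cycle_subG => /(_ Ty Tz)/orP[//|szy].
suff -> : <[z]> = <[y]> by apply: cycle_id.
by apply/eqP; rewrite eqEcard cycle_subG szy; apply: maxz.
Qed.

Lemma cyclic_cent_der1 T L : cyclic T -> L \subset 'N(T) -> L^`(1) \subset 'C(T).
Proof.
move=> cycT nTL; have nTL' := subset_trans (der_sub 1 L) nTL.
rewrite -ker_conj_aut -sub_morphim_pre // morphim_der //.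
suff /derG1P-> : abelian (conj_aut T @* L) by apply: sub1G.
exact: abelianS (Aut_conj_aut _ _) (Aut_cyclic_abelian cycT).
Qed.

Lemma minnormalJ T L g : minnormal T L -> minnormal (T :^ g) (L :^ g).
Proof.
case/mingroupP=> [/andP[ntT nTL] minT]; apply/mingroupP; split.
  by rewrite -subG1 sub_conjg conjs1g subG1 ntT normJ conjSg.
move=> H /andP[ntH nHL] sHT; apply: (@conjsg_inj _ g^-1).
rewrite -conjsgM mulgV conjsg1; apply: (minT (H :^ g^-1)%G).
  by rewrite /= -subG1 sub_conjg conjs1g subG1 ntH normJ -sub_conjg.
by rewrite /= sub_conjgV.
Qed.

End MoreGroupFacts.

Section CoverAvoid.

Variables (gT : finGroupType) (G M N : {group gT}).
Implicit Types H K L T X Y Z : {group gT}.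
Hypothesis modM : modular_in G M.
Hypothesis minN : minnormal N G.
Hypothesis sNG : N \subset G.

Let A := (M :&: N)%G.

Let nNG : G \subset 'N(N).
Proof. by case/mingroupP: minN => /andP[]. Qed.

Let NJ g : g \in G -> N :^ g = N.
Proof. by move/(subsetP nNG)/normP. Qed.

(* If some G-conjugate of a minimal L-invariant subgroup T of A is moved out of A
   by a p-element x, its subgroups embed in the chain of subgroups of <x>. *)
Lemma der1_cent_minnormal L :
    A :!=: 1 -> A :!=: N -> L <| G -> L \subset 'N(A) ->
  L^`(1) \subset 'C(N).
Proof.
move=> ntA neqAN nsLG nAL; have [sLG nLG] := andP nsLG.
have [T minT sTA] := minnormal_exists ntA nAL.
have [/andP[ntT nTL] _] := mingroupP minT.
have sAN : A \subset N := subsetIr _ _.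
have sAM : A \subset M := subsetIl _ _.
(* If [K] were normal in [G] it would be 1 or [N]. So some element of prime power order does not
   normalise [K], and it moves one of the generating conjugates out of [A]. *)
pose K := <<\bigcup_(g in [set g in G | T :^ g \subset A]) T :^ g>>%G.
have sKA : K \subset A.
  by rewrite gen_subG; apply/bigcupsP=> g; rewrite inE => /andP[].
have sTK g : g \in G -> T :^ g \subset A -> T :^ g \subset K.
  move=> Gg sTg; rewrite sub_gen // (bigcup_max g) // inE Gg //.
have nKG : ~~ (G \subset 'N(K)).
  apply/negP=> nKG.
  have [K1|KN] := minnormal_sub_eq minN (subset_trans sKA sAN) nKG.
    case/negP: ntT; rewrite -subG1 -K1.
    by have := sTK 1; rewrite conjsg1; apply.
  by case/eqP: neqAN; apply/eqP; rewrite eqEsubset sAN -KN.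
have [p [x Gx /andP[px nKx]]] := p_elt_notin nKG.
have [g /andP[Gg sTg] nsTgx] : exists2 g, (g \in G) && (T :^ g \subset A) & ~~ (T :^ (g * x) \subset A).
  apply/exists_inP; apply: contraR nKx; rewrite negb_exists_in => /forall_inP sT.
  rewrite -cycle_subG norms_gen // cycle_subG inE.
  apply/subsetP=> _ /imsetP[y /bigcupP[g sTg Tgy] ->].
  move: sTg; rewrite inE => /andP[Gg sTg].
  apply/bigcupP; exists (g * x); last by rewrite /= conjsgM memJ_conjg.
  rewrite inE groupM //=; have := sT g; rewrite negbK; apply; exact/andP.
pose T2 := (T :^ (g * x))%G; have Ggx : g * x \in G by rewrite groupM.
have minT2 : minnormal T2 L.
  by rewrite -(normP (subsetP nLG _ Ggx)); apply: minnormalJ.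
have [/andP[ntT2 nT2L] _] := mingroupP minT2.
have sT2N : T2 \subset N by rewrite -(NJ Ggx) conjSg (subset_trans sTA).
have tiMT2 : M :&: T2 = 1.
  have nL : L \subset 'N(A :&: T2) by rewrite normsI.
  have [tiA|E] := minnormal_sub_eq minT2 (subsetIr A T2) nL.
  - by rewrite -tiA /= -setIA (setIidPr sT2N).
  by case/negP: nsTgx; rewrite -[_ :^ _]E subsetIl.
have sT2x : T2 \subset M <*> <[x]>.
  have xMx : x \in M <*> <[x]> by rewrite mem_gen // inE cycle_id orbT.
  rewrite /= conjsgM -(conjGid xMx) conjSg (subset_trans sTg) //.
  by rewrite (subset_trans sAM) ?joing_subl.
have sT2G := subset_trans sT2N sNG.
have sxG : <[x]> \subset G by rewrite cycle_subG.
have cycT2 : cyclic T2.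
  apply: chain_cyclic => X Y sXT sYT.
  have E Z : Z \subset T2 -> (M <*> Z) :&: T2 = Z /\ M <*> (<[x]> :&: (M <*> Z)) = M <*> Z.
    move=> sZT; split; first by rewrite (modular_joinK modM) // tiMT2 sub1G.
    apply: (modular_capK (W := (M <*> Z)%G) modM) => //; first exact: joing_subl.
    by rewrite join_subG joing_subl (subset_trans sZT).
  have [[EX EX'] [EY EY']] := (E X sXT, E Y sYT).
  have := p_elt_cycle_chain (X := (<[x]> :&: (M <*> X))%G) (Y := (<[x]> :&: (M <*> Y))%G) px (subsetIl _ _) (subsetIl _ _).
  have mono (U V : {group gT}) : U \subset V -> M <*> U \subset M <*> V.
    by move=> sUV; rewrite genS ?setUS.
  case/orP=> /mono /=; rewrite EX' EY' => /(setSI T2); rewrite EX EY => ->//.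
  by rewrite orbT.
have cT2 := cyclic_cent_der1 cycT2 nT2L.
have nL'G : G \subset 'N(L^`(1)) by apply: gFnorm_trans.
(* The centraliser in [N] of the derived subgroup of [L] is invariant under [G] and contains [T2],
   so it is all of [N]. *)
have [||C1|CN] := minnormal_sub_eq minN (H := 'C_N(L^`(1))%G).
- exact: subsetIl.
- by rewrite normsI // norms_cent.
- by case/negP: ntT2; rewrite -subG1 -C1 subsetI sT2N centsC.
by rewrite centsC -CN subsetIr.
Qed.

(** * Nonabelian minimal normal subgroups *)

Section NonabelianFactor.

Hypothesis nabN : ~~ abelian N.

Let minnormal_conj T g : g \in G -> minnormal T N -> minnormal (T :^ g) N.
Proof. by move=> Gg minT; rewrite -(NJ Gg); apply: minnormalJ. Qed.

Let gen_conj T H :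
  T \subset N -> T :!=: 1 -> (forall g, g \in G -> T :^ g \subset H) -> N \subset H.
Proof.
move=> sTN ntT sTH; pose K := <<class_support T G>>%G.
have sKN : K \subset N.
  rewrite gen_subG class_supportEr; apply/bigcupsP=> g Gg.
  by rewrite -(NJ Gg) conjSg.
have nKG : G \subset 'N(K) by rewrite norms_gen // class_support_norm.
have [K1|<-] := minnormal_sub_eq minN sKN nKG.
  case/negP: ntT; rewrite -subG1 -K1 sub_gen // sub_class_support //.
by rewrite gen_subG class_supportEr; apply/bigcupsP.
Qed.

Let conj_cases T g : minnormal T N -> T \subset N -> g \in G ->
  T :^ g :=: T \/ T :^ g \subset 'C(T).
Proof.
move=> minT sTN Gg; have minTg := minnormal_conj Gg minT.
have [/andP[_ nTN] _] := mingroupP minT.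
have [/andP[_ nTgN] _] := mingroupP minTg.
have sTgN : T :^ g \subset N by rewrite -(NJ Gg) conjSg.
have nI : N \subset 'N(T :^ g :&: T) by rewrite normsI.
have [tiT|E] := minnormal_sub_eq minT (subsetIr (T :^ g) T) nI.
  right; apply/commG1P/trivgP; rewrite -tiT; apply: commg_subI.
    by rewrite subsetI subxx (subset_trans sTgN).
  by rewrite subsetI subxx (subset_trans sTN).
by left; apply/esym/eqP; rewrite eqEcard cardJg leqnn andbT -{1}E subsetIl.
Qed.

(** Each conjugate of [T] equals [T] or centralises it, and these conjugates generate [N]; so a
    normal subgroup of [T] is normal in [N]. If [T] were abelian it would be central in [N]. *)
Let minnormal_simple T : minnormal T N -> T \subset N -> simple T /\ ~~ abelian T.
Proof.
move=> minT sTN; have [/andP[ntT nTN] _] := mingroupP minT; split.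
  apply/simpleP; split=> // H /andP[sHT nHT].
  apply: (minnormal_sub_eq minT sHT); apply: (gen_conj sTN ntT) => g Gg.
  have [->//|cT] := conj_cases minT sTN Gg.
  by rewrite (subset_trans cT) // (subset_trans (centS sHT)) ?cent_sub.
apply/negP=> abT; have cTN : N \subset 'C(T).
  by apply: (gen_conj sTN ntT) => g Gg; have [->|] := conj_cases minT sTN Gg.
have nZ : G \subset 'N('Z(N)) by apply: gFnorm_trans.
have [Z1|ZN] := minnormal_sub_eq minN (center_sub N) nZ.
  by case/negP: ntT; rewrite -subG1 -Z1 subsetI sTN centsC.
by case/negP: nabN; rewrite -ZN center_abelian.
Qed.

(** If [M] meets [T] nontrivially, it contains [T] by the simple case. Otherwise modularity makes
    [A] normalise every subgroup of [T]. The group [F] of all such elements meets [T] in a normal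
    subgroup, not [T] itself as [T] is nonabelian simple; so [F] centralises [T]. *)
Let norm_minnormal T : minnormal T N -> T \subset N -> T \subset 'N(A).
Proof.
move=> minT sTN; have [simT nabT] := minnormal_simple minT sTN.
have sTG := subset_trans sTN sNG; have [/andP[ntT nTN] _] := mingroupP minT.
have [_ simE] := simpleP _ simT.
have sAN : A \subset N := subsetIr _ _.
have [tiMT|ntMT] := eqVneq (M :&: T) 1; last first.
  have [pMT|] := boolP (M :&: T \proper T).
    by case: (simple_modular_contra simT nabT (modularI sTG modM) ntMT pMT).
  rewrite properE subsetIr negbK subsetI subxx andbT => sTM.
  by rewrite (subset_trans _ (normG _)) // subsetI sTM.
suff cAT : A \subset 'C(T) by rewrite cents_norm // centsC.
pose F := (\bigcap_(Z : {group gT} | Z \subset T) 'N(Z))%G.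
have sAF : A \subset F.
  apply/bigcapsP=> Z sZT; rewrite -(modular_joinK modM sTG sZT) ?tiMT ?sub1G //.
  rewrite normsI ?(subset_trans sAN nTN) //.
  apply: subset_trans (normG (M <*> Z)%G).
  exact: subset_trans (subsetIl M N) (joing_subl M Z).
have nFT : T \subset 'N(F).
  apply/subsetP=> x Tx; rewrite inE; apply/subsetP=> _ /imsetP[f Ff ->].
  apply/bigcapP=> Z sZT; have sZxT : (Z :^ x^-1)%G \subset T.
    by rewrite /= sub_conjgV (conjGid Tx).
  have := bigcapP Ff _ sZxT; rewrite !inE /= -!conjsgM => sZ.
  by rewrite conjgE mulgA conjsgM sub_conjg.
have nFT' : F \subset 'N(T) by apply: (bigcap_inf T).
have nsFT : F :&: T <| T by rewrite /normal subsetIr normsI ?normG.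
have [tiF|FT] := simE (F :&: T)%G nsFT.
  apply: subset_trans sAF _; apply/commG1P/trivgP; rewrite -tiF.
  by apply: commg_subI; rewrite subsetI subxx.
case/negP: nabT; have /trivgPn[z Tz ntz] := ntT.
have nsZ : <[z]>%G <| T.
  rewrite /normal cycle_subG Tz; apply: subset_trans (_ : F \subset _).
    by rewrite -FT subsetIl.
  by apply: (bigcap_inf <[z]>%G); rewrite cycle_subG.
have [/eqP|<-] := simE _ nsZ; last exact: cycle_abelian.
by rewrite cycle_eq1 (negPf ntz).
Qed.

(** The conjugates of a minimal normal subgroup of [N] generate [N] and normalise [A], so
    [der1_cent_minnormal] applies with [N] for [L] and forces [N] to be abelian. *)
Lemma nonabelian_cover_avoid : A :=: 1 \/ A :=: N.
Proof.
have [A1|ntA] := eqVneq (A : {set gT}) 1; first by left.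
have [AN|neqAN] := eqVneq (A : {set gT}) N; first by right.
have ntN : N :!=: 1 by case/mingroupP: minN => /andP[].
have [T minT sTN] := minnormal_exists ntN (normG N).
have [/andP[ntT _] _] := mingroupP minT.
have nAN : N \subset 'N(A).
  apply: (gen_conj sTN ntT) => g Gg; apply: (norm_minnormal (T := (T :^ g)%G)).
    exact: minnormal_conj.
  by rewrite -(NJ Gg) conjSg.
have nsNG : N <| G by rewrite /normal sNG.
have cNN := der1_cent_minnormal ntA neqAN nsNG nAN.
have nN' : G \subset 'N(N^`(1)) by apply: gFnorm_trans.
case/negP: nabN; have [N1|<-] := minnormal_sub_eq minN (der_sub 1 N) nN'.
  exact/derG1P.
by rewrite /abelian (subset_trans cNN) // centS // der_sub.
Qed.

End NonabelianFactor.

End CoverAvoid.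

(** * Abelian minimal normal subgroups *)

Section AbelianFactor.

Variables (gT : finGroupType) (G M N : {group gT}).
Implicit Types H K L Q S T X Y Z : {group gT}.
Hypothesis modM : modular_in G M.
Hypothesis minN : minnormal N G.
Hypothesis sNG : N \subset G.
Hypothesis abN : abelian N.

Let A := (M :&: N)%G.

Hypothesis ntA : A :!=: 1.
Hypothesis neqAN : A :!=: N.

Let nNG : G \subset 'N(N).
Proof. by case/mingroupP: minN => /andP[]. Qed.

Let sMG := modular_sub modM.
Let sAM : A \subset M. Proof. exact: subsetIl. Qed.
Let sAN : A \subset N. Proof. exact: subsetIr. Qed.

Let nAG : ~~ (G \subset 'N(A)).
Proof.
apply/negP=> nAG; have [/eqP|/eqP] := minnormal_sub_eq minN sAN nAG.
  by rewrite (negPf ntA).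
by rewrite (negPf neqAN).
Qed.

Let nAN : N \subset 'N(A).
Proof. by rewrite cents_norm // (subset_trans abN) // centS. Qed.

(** By the second modular law [M <*> Q] meets [M <*> N] in [M]. Hence [A] is the intersection of
    [M <*> Q] and [N], both normalised by [Q]. *)
Let norm_avoid Q : Q \subset G -> Q :&: (M <*> N) \subset M ->
  (M <*> Q) :&: N = A /\ Q \subset 'N(A).
Proof.
move=> sQG sQM; have E : (M <*> Q) :&: N = A.
  apply/eqP; rewrite eqEsubset; apply/andP; split; last by rewrite setSI ?joing_subl.
  rewrite subsetI subsetIr andbT.
  apply: subset_trans (setIS _ (joing_subr M N)) _.
  have sW : M <*> N \subset G by rewrite join_subG sMG.
  have := modular_joinIW modM sQG sW (joing_subl _ _) => /= ->.
  by rewrite join_subG subxx.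
split=> //; rewrite /= -E normsI ?(subset_trans sQG nNG) //.
by apply: subset_trans (normG (M <*> Q)%G); apply: joing_subr.
Qed.

Let conj_avoid (p q : nat) Q :
    p.-group N -> q != p -> q.-group Q ->
  exists2 n, n \in N & Q :^ n :&: (M <*> N) \subset M.
Proof.
move=> pN neq_qp qQ; have [S sylS] := Sylow_exists q M.
have defMN : M <*> N = N * M by rewrite joingC norm_joinEr // (subset_trans sMG).
have defMN' : M <*> N = M * N by rewrite norm_joinEl // (subset_trans sMG).
have [sSM qS q'S] := and3P sylS.
have sylS' : q.-Sylow(M <*> N) S.
  rewrite /pHall (subset_trans sSM) ?joing_subl // qS /=.
  rewrite -(Lagrange_index (joing_subl M N) sSM) pnatM q'S andbT /=.
  rewrite defMN' indexMg -indexgI.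
  apply: pnat_dvd (dvdn_indexg _ _) _; apply: sub_in_pnat pN => r _ /eqP ->.
  by rewrite !inE eq_sym.
have qQ0 : q.-group (Q :&: (M <*> N)) by rewrite (pgroupS (subsetIl _ _)).
have [y MNy sQy] := Sylow_Jsub sylS' (subsetIr Q _) qQ0.
have /mulsgP[n m Nn Mm defy] : y \in N * M by rewrite -defMN.
exists n => //; have MNn : n \in M <*> N by rewrite mem_gen // inE Nn orbT.
rewrite -{1}(conjGid MNn) -conjIg -(conjSg _ _ m) -conjsgM -defy (conjGid Mm).
exact: subset_trans sSM.
Qed.

Let norm_p'group (p q : nat) Q :
  p.-group N -> q != p -> Q \subset G -> q.-group Q -> Q \subset 'N(A).
Proof.
move=> pN neq_qp sQG qQ; have [n Nn sQn] := conj_avoid pN neq_qp qQ.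
have sQnG : (Q :^ n)%G \subset G by rewrite /= -(conjGid (subsetP sNG n Nn)) conjSg.
have [_] := norm_avoid sQnG sQn.
by rewrite /= sub_conjg conjGid ?groupV // (subsetP nAN).
Qed.

(** [H / C] is abelian. If it is not a p-group, let [S / C] be its q-part for another prime [q]. The
    Frattini argument for a Sylow q-subgroup [Q] of [S] gives [G = C * L], and both factors
    normalise [A], against [nAG]. *)
Lemma abelian_cover_avoid_contra : False.
Proof.
have [_ ntN /is_abelemP[p pr_p /abelem_pgroup pN]] := minnormal_solvable minN (subxx _) (abelian_sol abN).
set C := 'C_G(N)%G; have sCG : C \subset G := subsetIl _ _.
have nCG : G \subset 'N(C) by rewrite normsI ?normG ?norms_cent.
have nsCG : C <| G by rewrite /normal sCG.
have cCN : C \subset 'C(N) := subsetIr _ _.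
have cNC : N \subset 'C(C) by rewrite centsC.
have nAC : C \subset 'N(A) by rewrite cents_norm // (subset_trans cCN) // centS.
pose H := [group of gcore 'N_G(A) G].
have nsHG : H <| G by apply: gcore_normal; apply: subsetIl.
have [sHG nHG] := andP nsHG.
have nAH : H \subset 'N(A) by rewrite (subset_trans (gcore_sub _ _)) ?subsetIr.
have sCH : C \subset H by rewrite gcore_max // subsetI sCG.
have sQH q Q : q != p -> Q \subset G -> q.-group Q -> Q \subset H.
  move=> neq sQG qQ; apply/bigcapsP=> g Gg; rewrite -sub_conjgV.
  rewrite subsetI (@norm_p'group p q (Q :^ g^-1)%G) ?pgroupJ //.
    by rewrite andbT sub_conjgV (conjGid Gg).
  by rewrite /= sub_conjgV (conjGid Gg).
have cHN := der1_cent_minnormal modM minN sNG ntA neqAN nsHG nAH.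
have abHC : abelian (H / C).
  by rewrite sub_der1_abelian // subsetI cHN (subset_trans (der_sub _ _)).
have ntCN (K : {group gT}) : K <| G -> ~~ (K \subset C) -> 'C_N(K) = 1.
  case/andP=> sKG nKG nsKC; have nCNK : G \subset 'N('C_N(K)) by rewrite normsI // norms_cent.
  have [//|E] := minnormal_sub_eq minN (subsetIl N 'C(K)) nCNK.
  by case/negP: nsKC; rewrite subsetI sKG centsC -E subsetIr.
(* If H / C is a p-group then so is G / C, and N is central in G. *)
have [pHC|] := boolP (p.-group (H / C)).
  have pGC : p.-group (G / C).
    apply/pgroupP=> q pr_q qGC; apply: contraLR qGC; rewrite inE /= => neq.
    have [Q sylQ] := Sylow_exists q G; have [sQG qQ _] := and3P sylQ.
    have nCQ := subset_trans sQG nCG.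
    have sylQC : q.-Sylow(G / C) (Q / C) by apply: quotient_pHall.
    have : q.-group (Q / C) by apply: quotient_pgroup.
    have : p.-group (Q / C) by rewrite (pgroupS (quotientS C (sQH q Q neq sQG qQ))).
    move=> pQC qQC; have QC1 : #|Q / C| = 1%N.
      apply: (pnat_1 pQC); apply: sub_in_pnat qQC => r _ /eqP->.
      by rewrite !inE.
    rewrite -p'natE //; have [_ _] := and3P sylQC.
    by rewrite (card1_trivg QC1) indexg1.
  have [P sylP] := Sylow_exists p G; have [sPG pP _] := and3P sylP.
  have sGCP : G \subset C * P.
    rewrite -quotientSK // -(pHall_id (quotient_pHall _ sylP)) //.
    exact: subset_trans sPG nCG.
  have sNP : N \subset P.
    by rewrite (normal_sub_max_pgroup (Hall_max sylP)) // /normal sNG.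
  have nsNP : N <| P by rewrite /normal sNP (subset_trans sPG).
  have ntNZ := meet_center_nil (pgroup_nil pP) nsNP ntN.
  have nCNG : G \subset 'N('C_N(G)) by rewrite normsI ?norms_cent ?normG.
  case/negP: nAG; have [E|E] := minnormal_sub_eq minN (subsetIl N 'C(G)) nCNG.
    case/negP: ntNZ; rewrite -subG1 -E subsetI subsetIl /= centsC.
    rewrite (subset_trans sGCP) // mul_subG //.
      by rewrite (subset_trans cCN) // centS // subsetIl.
    by rewrite centsC (subset_trans (subsetIr _ _)) // subsetIr.
  by rewrite cents_norm // (subset_trans _ (centS sAN)) // centsC -E subsetIr.
rewrite /pgroup /pnat cardG_gt0 /= => /allPn[q].
rewrite mem_primes => /and3P[pr_q _ qHC]; rewrite inE /= => neq_qp.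
have sylO : q.-Sylow(H / C) 'O_q(H / C).
  by apply: nilpotent_pcore_Hall; apply: abelian_nil.
have nsO : 'O_q(H / C) <| G / C.
  exact: char_normal_trans (pcore_char _ _) (quotient_normal _ nsHG).
have [S defS sCS nsSG] := inv_quotientN nsCG nsO.
have [sSG nSG] := andP nsSG.
have nsSC : ~~ (S \subset C).
  rewrite -quotient_sub1 ?(subset_trans sSG) // -defS; apply/negP=> /trivgP O1.
  have := card_Hall sylO; rewrite O1 cards1 => /esym/eqP.
  by rewrite p_part_eq1 mem_primes pr_q cardG_gt0 qHC.
have CNS := ntCN S nsSG nsSC.
have [Q0 sylQ0] := Sylow_exists q S.
have [n Nn sQM] := conj_avoid pN neq_qp (pHall_pgroup sylQ0).
pose Q := (Q0 :^ n)%G.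
have sylQ : q.-Sylow(S) Q.
  by rewrite -(normP (subsetP nSG n (subsetP sNG n Nn))) pHallJ2.
have [sQS qQ _] := and3P sylQ; have sQG := subset_trans sQS sSG.
have sSCQ : S \subset C * Q.
  rewrite -quotientSK ?(subset_trans sSG) //.
  have qSC : q.-group (S / C) by rewrite -defS pcore_pgroup.
  by rewrite (pHall_id (quotient_pHall (subset_trans sQG nCG) sylQ) qSC).
have CNQ : 'C_N(Q) = 1.
  apply/trivgP; rewrite -CNS subsetI subsetIl /= centsC (subset_trans sSCQ) //.
  rewrite mul_subG //; first by rewrite centsC (subset_trans (subsetIl _ _)).
  by rewrite centsC subsetIr.
have NNQ : 'N_N(Q) = 1.
  have tiNQ : N :&: Q = 1.
    by rewrite coprime_TIg // (pnat_coprime pN) //; apply: sub_in_pnat qQ => r _ /eqP->.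
  apply/trivgP; rewrite -CNQ subsetI subsetIl /=; apply/commG1P/trivgP.
  rewrite -tiNQ; apply: commg_subI; first by [].
  by rewrite subsetI subxx (subset_trans sQG).
pose L := 'N_G(Q)%G; have sLG : L \subset G := subsetIl _ _.
have [MQN nAQ] := norm_avoid sQG sQM.
have sMQG : M <*> Q \subset G by rewrite join_subG sMG.
(* As N_N(Q) = 1, all elements of M <*> Q <*> N normalising Q lie in M <*> Q. *)
pose W := (M <*> Q <*> N)%G.
have sWG : W \subset G by rewrite join_subG sMQG.
have defW : W :=: (M <*> Q) * N by rewrite /= norm_joinEl ?(subset_trans sMQG).
have sLW : L :&: W \subset M <*> Q.
  apply/subsetP=> y /setIP[/setIP[Gy nQy]]; rewrite defW => /mulsgP[m b MQm Nb defy].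
  have nQm : Q :^ m = Q :^ b^-1.
    by rewrite -{2}(normP nQy) defy -conjsgM mulgK.
  have defQA : Q <*> A = Q * A by rewrite norm_joinEl.
  (* [Q :^ m] lies in [Q * N] and in [M <*> Q], which intersect in [Q * A] by Dedekind's law. *)
  have sQm : Q :^ m \subset Q <*> A.
    rewrite defQA -MQN setIC group_modl ?joing_subr //= subsetI; apply/andP; split.
      rewrite nQm -norm_joinEl ?(subset_trans sQG) //.
      have QNb : b \in Q <*> N by rewrite mem_gen // inE Nb orbT.
      by rewrite sub_conjgV conjGid // joing_subl.
    by rewrite sub_conjg (conjGid (groupVr MQm)) joing_subr.
  have sylQA : q.-Sylow(Q <*> A) Q.
    rewrite /pHall joing_subl qQ defQA indexMg.
    apply: pnat_dvd (dvdn_indexg _ _) _; apply: sub_in_pnat (pgroupS sAN pN) => r _ /eqP ->.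
    by rewrite !inE eq_sym.
  have qQm : q.-group (Q :^ m) by rewrite pgroupJ.
  have [j QAj sQmj] := Sylow_Jsub sylQA sQm qQm.
  have /mulsgP[a c Aa Qc defj] : j \in A * Q by rewrite -norm_joinEr // joingC.
  (* [a * c] conjugates [Q :^ m = Q :^ b^-1] into [Q], and [c] lies in [Q]. So [b^-1 * a] normalises
     [Q], and triviality of ['N_N(Q)] puts [b = a] in [M]. *)
  have nQa : b^-1 * a \in 'N_N(Q).
    apply/setIP; split; first by rewrite groupM ?groupV // (subsetP sAN a Aa).
    apply/normP/eqP.
    rewrite eqEcard cardJg leqnn andbT conjsgM -nQm.
    by rewrite -(conjSg _ _ c) -conjsgM -defj (conjGid Qc).
  move: nQa; rewrite NNQ => /set1P/(canRL (mulKVg _)); rewrite mulg1 => ab.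
  by rewrite defy groupM // (subsetP (joing_subl _ _)) // -ab (subsetP sAM).
case/negP: nAG.
have sGCL : G \subset C * L.
  have sQL : Q \subset L by apply/subsetIP; split; [apply: sQG | apply: normG].
  rewrite -{1}(Frattini_arg nsSG sylQ) (subset_trans (mulSg _ sSCQ)) //.
  by rewrite -mulgA (mulSGid sQL).
rewrite (subset_trans sGCL) // mul_subG //.
(* As in [norm_avoid], [M <*> L] meets [W] in [M <*> (L :&: W)], now inside [M <*> Q], which meets
   [N] in [A]. *)
have E : (M <*> L) :&: N = A.
  apply/eqP; rewrite eqEsubset; apply/andP; split; last by rewrite setSI ?joing_subl.
  rewrite -MQN subsetI subsetIr andbT.
  apply: subset_trans (setIS _ (joing_subr (M <*> Q) N)) _.
  have sMW : M \subset W by rewrite (subset_trans _ (joing_subl _ _)) ?joing_subl.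
  have := modular_joinIW modM sLG sWG sMW => /= ->.
  by rewrite join_subG joing_subl.
rewrite /= -E normsI ?(subset_trans sLG nNG) //.
by apply: subset_trans (normG (M <*> L)%G); apply: joing_subr.
Qed.

End AbelianFactor.

(** * Chains of modular subgroups *)

Lemma minnormal_cover_avoid (gT : finGroupType) (G M N : {group gT}) :
    modular_in G M -> minnormal N G -> N \subset G ->
  M :&: N = 1 \/ M :&: N = N.
Proof.
move=> modM minN sNG; have [abN|nabN] := boolP (abelian N); last first.
  exact: (nonabelian_cover_avoid modM minN sNG nabN).
have [?|ntA] := eqVneq (M :&: N) 1; first by left.
have [?|neqAN] := eqVneq (M :&: N) N; first by right.
by case: (abelian_cover_avoid_contra modM minN sNG abN ntA neqAN).
Qed.

Lemma chief_cover_avoid (gT : finGroupType) (G K M N : {group gT}) :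
    modular_in G M -> chief_factor G K N ->
  (M <*> K) :&: N \subset K \/ N \subset M <*> K.
Proof.
move=> modM chKN; have [maxK nsNG] := andP chKN.
have [/andP[pKN nKG] _] := maxgroupP maxK.
have sKN := proper_sub pKN; have sNG := normal_sub nsNG.
have nsKG : K <| G by rewrite /normal (subset_trans sKN).
have nKM := subset_trans (modular_sub modM) nKG.
have nKN := subset_trans sNG nKG.
have [ti|cov] := minnormal_cover_avoid (quotient_modular nsKG modM)
                   (chief_factor_minnormal chKN) (quotientS K sNG).
  left; rewrite -quotient_sub1 ?subIset ?nKN ?orbT //.
  rewrite quotientIG // quotientYidr //.
  by apply/trivgP; apply: ti.
right; have : N / K \subset M / K by apply/setIidPr; apply: cov.
by rewrite quotientSK // joingC norm_joinEr.
Qed.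

Section ChiefSeries.

Variables (gT : finGroupType) (G : {group gT}) (s : seq {group gT}).
Hypothesis chief_s : chief_series G s.

Let N i := nth 1%G (1%G :: s) i.

Let chief_N i : i < size s -> chief_factor G (N i) (N i.+1).
Proof. by have [/pathP-chs _] := andP chief_s; apply: chs. Qed.

Let lastN : N (size s) = G.
Proof. by have [_ /eqP <-] := andP chief_s; rewrite (last_nth 1%G). Qed.

Let normalN i : i <= size s -> N i <| G.
Proof.
case: i => [_|i lti]; first exact: normal1.
by case/andP: (chief_N lti).
Qed.

Definition covered (M : {group gT}) : {set 'I_(size s)} :=
  [set i : 'I_(size s) | N i.+1 \subset M <*> N i].

Lemma coveredS (M1 M2 : {group gT}) :
  M1 \subset M2 -> covered M1 \subset covered M2.
Proof.
move=> sM; apply/subsetP=> i; rewrite !inE => /subset_trans; apply.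
by rewrite genS // setSU.
Qed.

(** Climbing the series, [M2 :&: N i] stays inside [M1]: at a covered factor an element of [M2]
    splits as one of [M1] times one of [M2 :&: N i], and at an avoided factor [M2] gains nothing. *)
Lemma covered_inj (M1 M2 : {group gT}) :
    modular_in G M1 -> modular_in G M2 -> M1 \subset M2 ->
  covered M1 = covered M2 -> M1 = M2.
Proof.
move=> mod1 mod2 sM12 eqcov; apply/val_inj/eqP; rewrite eqEsubset sM12 /=.
have sub i : i <= size s -> M2 :&: N i \subset M1.
  elim: i => [_|i IHi lti]; first by rewrite subIset // sub1G orbT.
  have {}IHi := IHi (ltnW lti).
  have [cov|ncov] := boolP (Ordinal lti \in covered M1).
    move: cov; rewrite inE /= norm_joinEl; last first.
      apply: subset_trans (modular_sub mod1) (normal_norm (normalN (ltnW lti))).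
    move=> cov; apply/subsetP=> x /setIP[M2x Nx].
    have /mulsgP[m n Mm Nn defx] := subsetP cov x Nx.
    rewrite defx groupM // (subsetP IHi) //; apply/setIP; split=> //.
    by rewrite -(groupMl _ (subsetP sM12 m Mm)) -defx.
  have [av|cov] := chief_cover_avoid mod2 (chief_N lti).
    apply: subset_trans IHi; rewrite subsetI subsetIl.
    by apply: subset_trans av; rewrite setSI ?joing_subl.
  by case/negP: ncov; rewrite eqcov inE.
have := sub (size s) (leqnn _); rewrite lastN.
by rewrite (setIidPl (modular_sub mod2)).
Qed.

(** The number of covered factors separates the members of [C] and takes at most [size s + 1]
    values, while the length of [C] is one less than its cardinality. *)
Lemma modular_chain_length C : modular_chain G C -> chain_length C <= size s.
Proof.
case/andP=> /andP[_ /forall_inP-chC] /forall_inP-modC.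
pose f M : 'I_(size s).+1 := inord #|covered M|.
have fE M : f M = #|covered M| :> nat.
  by rewrite inordK // ltnS -[X in _ <= X]card_ord max_card.
have injf : {in C &, injective f}.
  have wlog M1 M2 : M1 \in C -> M2 \in C -> M1 \subset M2 -> f M1 = f M2 -> M1 = M2.
    move=> C1 C2 sM /(congr1 val); rewrite /= !fE => eqf.
    apply: covered_inj; rewrite ?modC //.
    by apply/eqP; rewrite eqEcard coveredS // eqf leqnn.
  move=> M1 M2 C1 C2 eqf; have /forall_inP/(_ _ C2) := chC _ C1.
  by case/orP=> sM; [|symmetry]; apply: wlog.
rewrite /chain_length -(card_in_imset injf) -subn1 leq_subLR add1n.
by rewrite -[X in _ <= X]card_ord max_card.
Qed.

Lemma chief_chain : exists2 C, modular_chain G C & chain_length C = size s.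
Proof.
have sN i : i < size s -> N i \proper N i.+1.
  by move/chief_N=> /andP[/maxgroupp/andP[]].
have path_s : path (fun H K : {group gT} => H \proper K) 1%G s by apply/(pathP 1%G).
have tr : transitive (fun H K : {group gT} => H \proper K).
  by move=> H K L; apply: proper_trans.
have irr : irreflexive (fun H K : {group gT} => H \proper K).
  by move=> H; apply: properxx.
exists [set H in 1%G :: s]; last first.
  rewrite /chain_length cardsE /=.
  by rewrite (card_uniqP (sorted_uniq tr irr (s := 1%G :: s) path_s)).
have normalH H : H \in 1%G :: s -> H <| G.
  by case/(nthP 1%G)=> i lti <-; apply: normalN.
apply/andP; split; last first.
  by apply/forall_inP=> H; rewrite inE => /normalH/normal_modular.
apply/andP; split.
  by apply/subsetP=> H; rewrite !inE => /normalH/normal_sub.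
have le_nth i j : i <= j -> j <= size s -> N i \subset N j.
  elim: j => [|j IHj]; first by rewrite leqn0 => /eqP->.
  rewrite leq_eqVlt => /orP[/eqP->//|leij] ltj.
  exact: subset_trans (IHj leij (ltnW ltj)) (proper_sub (sN _ ltj)).
apply/forall_inP=> H; rewrite inE => /(nthP 1%G)[i lti <-].
apply/forall_inP=> K; rewrite inE => /(nthP 1%G)[j ltj <-].
by case: (leqP i j) => [|/ltnW] leij; apply/orP; [left | right]; apply: le_nth.
Qed.

End ChiefSeries.

Local Close Scope group_scope.

Theorem theorem1p2 (gT : finGroupType) (G : {group gT})
    (s : seq {group gT}) (hs : chief_series G s) :
  modl G = size s
  /\ (forall C : {set {group gT}},
        modular_chain G C -> chain_length C <= size s).
Proof.
have le C := @modular_chain_length gT G s hs C; split=> //.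
apply/eqP; rewrite eqn_leq; apply/andP; split.
  by apply/bigmax_leqP=> C /le.
by have [C modC <-] := chief_chain hs; apply: leq_bigmax_cond.
Qed.
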